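(* MEFE-Matching can be solved in polynomial time on instances in which the number of courses is one. That is, there is a polynomial-time algorithm that, given such an instance, outputs a MEFE matching if one exists and correctly reports that none exists otherwise.
   Context: An instance of MEFE-Matching consists of: a finite set of courses $X=\{x_1,\dots,x_n\}$; a finite set of TAs $T=\{t_1,\dots,t_m\}$; for each TA $t_i$ a utility (valuation) function $u_i=u_{t_i}\colon X\to\mathbb{Z}_{\ge 0}$ and a grade function $g_i=g_{t_i}\colon X\to\mathbb{Q}_{\ge 0}$; for each course $x_i$ a capacity $c_i$ (a positive integer) and a utility (valuation) function $v_i=v_{x_i}\colon T\to\mathbb{Z}_{\ge 0}$, where for every TA $t$ and course $x_i$ one has $v_i(t)=0$ if $u_t(x_i)=0$ and $v_i(t)>0$ otherwise; and a number $k\in\mathbb{Q}_{\ge 0}$. All numbers are encoded in binary. A matching is a function $\mu\colon T\to X\cup\{\emptyset\}$, where $\mu(t)=\emptyset$ means $t$ is unassigned; by convention $u_t(\emptyset)=0$. It is feasible if $|\mu^{-1}(x_i)|=c_i$ for every course $x_i$ and no TA $t$ is assigned to a course $x$ with $u_t(x)=0$. A MEFE (merit-based envy-free egalitarian) matching is a feasible matching $\mu$ such that (1) (satisfaction of courses) for every course $x_i$, $\mathrm{AvgUtil}(x_i)=\frac{1}{c_i}\sum_{t\in\mu^{-1}(x_i)}v_i(t)\ge k$; and (2) (merit-based envy-freeness) there are no two TAs $t_i,t_j$ with $\mu(t_j)\in X$, $g_i(\mu(t_j))\ge g_j(\mu(t_j))$ and $u_i(\mu(t_j))>u_i(\mu(t_i))$.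 *)

(* Defs.v *)
From Corelib Require Import BinNums.
From HB Require Import structures.
From mathcomp Require Import all_boot all_order all_algebra.

Set Implicit Arguments.
Unset Strict Implicit.
Unset Printing Implicit Defensive.

Import Order.TTheory GRing.Theory Num.Theory.
Local Open Scope ring_scope.

Record instance := Instance {
  courses : nat;
  tas : nat;
  ta_util : 'I_tas -> 'I_courses -> nat;
  grade : 'I_tas -> 'I_courses -> rat;
  capacity : 'I_courses -> nat;
  course_util : 'I_courses -> 'I_tas -> nat;
  threshold : rat;
  grade_ge0 : forall t x, 0 <= grade t x;
  capacity_gt0 : forall x, (0 < capacity x)%N;
  course_util0 : forall t x, ta_util t x = 0%N -> course_util x t = 0%N;
  course_util_gt0 : forall t x, ta_util t x <> 0%N -> (0 < course_util x t)%N;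
  threshold_ge0 : 0 <= threshold
}.

(* [None] is the empty assignment. *)
Definition matching (I : instance) := {ffun 'I_(tas I) -> option 'I_(courses I)}.

Section Matching.
Variables (I : instance) (mu : matching I).

Definition ta_util_opt (t : 'I_(tas I)) (a : option 'I_(courses I)) : nat :=
  if a is Some x then ta_util t x else 0%N.

Definition assigned (x : 'I_(courses I)) : {set 'I_(tas I)} :=
  [set t | mu t == Some x].

Definition feasible : Prop :=
  (forall x, #|assigned x| = capacity x) /\
  (forall t x, mu t = Some x -> ta_util t x <> 0%N).

Definition avg_util (x : 'I_(courses I)) : rat :=
  (capacity x)%:R^-1 * \sum_(t in assigned x) (course_util x t)%:R.

Definition satisfies_courses : Prop := forall x, threshold I <= avg_util x.

Definition merit_envies (t t' : 'I_(tas I)) : Prop :=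
  exists x, [/\ mu t' = Some x, grade t' x <= grade t x &
                (ta_util_opt t (mu t) < ta_util t x)%N].

Definition merit_envy_free : Prop :=
  ~ exists t t', t <> t' /\ merit_envies t t'.

Definition MEFE : Prop :=
  [/\ feasible, satisfies_courses & merit_envy_free].

End Matching.

Definition correct_answer (I : instance) (ans : option (matching I)) : Prop :=
  if ans is Some mu then MEFE mu else ~ exists mu : matching I, MEFE mu.

(* Words over the three letters 0, 1 ([Some false], [Some true]) and a
   separator ([None]). *)
Definition letter : Type := option bool.

Fixpoint bits_pos (p : positive) : seq bool :=
  match p with
  | xH => [:: true]
  | xO q => false :: bits_pos q
  | xI q => true :: bits_pos q
  end.

(* Least significant bit first, no superfluous zeros; 0 is the empty word. *)
Definition bits (n : nat) : seq bool :=
  if bin_of_nat n is Npos p then bits_pos p else [::].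

Definition enc_nats (s : seq nat) : seq letter :=
  flatten [seq rcons [seq Some b | b <- bits n] None | n <- s].

(* Numerator and denominator in lowest terms; only used on nonnegative
   rationals, for which dropping the sign loses nothing. *)
Definition rat_nats (r : rat) : seq nat := [:: `|numq r|%N; `|denq r|%N].

Definition enc_instance (I : instance) : seq letter :=
  let T := enum 'I_(tas I) in
  let X := enum 'I_(courses I) in
  enc_nats ([:: courses I; tas I]
    ++ [seq ta_util t x | t <- T, x <- X]
    ++ flatten [seq rat_nats (grade t x) | t <- T, x <- X]
    ++ [seq capacity x | x <- X]
    ++ [seq course_util x t | x <- X, t <- T]
    ++ rat_nats (threshold I)).

(* A leading 0 reports that there is no MEFE matching; a leading 1 is followed
   by one number per TA: 0 if unassigned, j.+1 for the course of index j. *)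
Definition enc_answer (I : instance) (ans : option (matching I)) : seq letter :=
  enc_nats (if ans is Some mu
            then 1%N :: [seq (if mu t is Some x then (val x).+1 else 0%N)
                        | t <- enum 'I_(tas I)]
            else [:: 0%N]).

Inductive direction := MoveLeft | Stay | MoveRight.

(* A cell is blank ([None]) or holds an input/output letter ([inl]) or an
   auxiliary tape symbol ([inr]). *)
Definition cell (A W : Type) : Type := option (A + W).

Record machine (A : finType) := Machine {
  work : finType;
  extra_tapes : nat;
  state : finType;
  start : state;
  halting : pred state;
  trans : state -> {ffun 'I_extra_tapes.+1 -> cell A work} ->
          state * {ffun 'I_extra_tapes.+1 -> cell A work * direction}
}.

(* A two-way infinite tape: the cells left of the head (nearest first), the
   scanned cell, the cells right of the head; everything beyond is blank. *)
Record tape (A W : Type) := Tape {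
  to_left : seq (cell A W);
  scanned : cell A W;
  to_right : seq (cell A W)
}.

Section Tape.
Variables A W : Type.

Definition move_head (d : direction) (tp : tape A W) : tape A W :=
  let: Tape l c r := tp in
  match d with
  | MoveLeft => Tape (behead l) (head None l) (c :: r)
  | Stay => tp
  | MoveRight => Tape (c :: l) (head None r) (behead r)
  end.

Definition write (c : cell A W) (tp : tape A W) : tape A W :=
  Tape (to_left tp) c (to_right tp).

(* Head on the first letter of [w], all other cells blank. *)
Definition tape_of_word (w : seq A) : tape A W :=
  let s := [seq Some (inl a) | a <- w] in Tape [::] (head None s) (behead s).

Fixpoint read_letters (s : seq (cell A W)) : seq A :=
  if s is Some (inl a) :: s' then a :: read_letters s' else [::].

(* The longest word of letters starting at the head. *)
Definition word_of_tape (tp : tape A W) : seq A :=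
  read_letters (scanned tp :: to_right tp).

End Tape.

Section Run.
Variables (A : finType) (M : machine A).

Record config := Config {
  cstate : state M;
  ctapes : {ffun 'I_(extra_tapes M).+1 -> tape A (work M)}
}.

(* The input is on the first tape and the output on the last one (the same
   tape if the machine has only one). *)
Definition init (w : seq A) : config :=
  Config (start M) [ffun i => tape_of_word (work M) (if i == ord0 then w else [::])].

Definition step (c : config) : config :=
  if halting (cstate c) then c else
  let: (q, act) := trans (cstate c) [ffun i => scanned (ctapes c i)] in
  Config q [ffun i => move_head (act i).2 (write (act i).1 (ctapes c i))].

Definition output (c : config) : seq A := word_of_tape (ctapes c ord_max).

(* [M] halts on [w] after at most [n] steps, with output [w']: a halted
   configuration is a fixed point of [step]. *)
Definition outputs_within (w : seq A) (n : nat) (w' : seq A) : Prop :=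
  let c := iter n step (init w) in halting (cstate c) /\ output c = w'.

End Run.

Definition MEFE_matching_polytime_on (C : instance -> Prop) : Prop :=
  exists (M : machine letter) (p : {poly nat}), forall I : instance, C I ->
    exists2 ans : option (matching I), correct_answer ans &
      outputs_within M (enc_instance I) p.[size (enc_instance I)] (enc_answer ans).

(* Main.v *)
(** With a single course x of capacity c, let A be the set of TAs with positive
    utility for x (equivalently, of positive value to x). Merit-based
    envy-freeness says that the assigned set is closed upward in A for the grade,
    so a MEFE matching can only assign x to the TAs t of A for which at most c
    members of A have a grade at least that of t. This set never has more than c
    elements; it is a MEFE matching iff it has at least c elements and its average
    value reaches the threshold. All this is decided by binary additions,
    multiplications and comparisons on a Turing machine whose tapes are used as
    stacks of binary words. *)

Require Import Defs.
From mathcomp Require Import all_boot all_order all_algebra.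
From mathcomp Require Import zify.

Set Implicit Arguments.
Unset Strict Implicit.
Unset Printing Implicit Defensive.

(** * Turing machine fragments acting on stacks *)

(** The obstacle is that the time bound concerns a concrete Turing machine. The machine is therefore
    assembled from fragments whose composition rules give both the effect on the stacks and an upper
    bound on the number of steps, so that no proof about the algorithm mentions heads or states.
    Ranking by counting avoids sorting and tie-breaking: each TA is treated independently, by one
    pass over all records. Grades and the threshold are compared by cross multiplication, so only
    natural numbers occur. It is, because the single course has index 0: every answer number is 0 or
    1, and the words [[::]] and [[:: true]] of these numbers are exactly the two possible results of
    a comparison, which are moved to the output as they are. *)

Section Fragments.
Variable K : nat.

Notation stape := (tape letter void).
Notation stapes := {ffun 'I_K.+1 -> tape letter void}.
Notation reads := {ffun 'I_K.+1 -> cell letter void}.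
Notation acts := {ffun 'I_K.+1 -> cell letter void * direction}.

(** A fragment leaves by a transition to [None] that still performs its action. Composition
    redirects this exit to the start of another fragment, so sequencing costs no extra step. *)
Record frag := Frag {
  fstate : finType;
  fstart : fstate;
  ftrans : fstate -> reads -> option fstate * acts
}.

Definition scan (tp : stapes) : reads := [ffun i => scanned (tp i)].

Definition perform (act : acts) (tp : stapes) : stapes :=
  [ffun i => move_head (act i).2 (write (act i).1 (tp i))].

Inductive frun (F : frag) : fstate F -> stapes -> nat -> stapes -> Prop :=
| FrunExit q tp act :
    ftrans q (scan tp) = (None, act) -> frun q tp 1 (perform act tp)
| FrunStep q q' tp act n tp' :
    ftrans q (scan tp) = (Some q', act) ->
    frun q' (perform act tp) n tp' -> frun q tp n.+1 tp'.

Definition idle (r : reads) : acts := [ffun i => (r i, Stay)].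

Definition act_on (k : nat) (c : cell letter void) (d : direction) (r : reads) :
    acts :=
  [ffun i : 'I_K.+1 => if i == k :> nat then (c, d) else (r i, Stay)].

Definition letter_of (c : cell letter void) : option letter :=
  if c is Some (inl a) then Some a else None.

Definition skip : frag := @Frag unit tt (fun _ r => (None, idle r)).

(** Two transitions, because a transition writes before it moves: the head first goes left with the
    old top kept, then writes on the new cell. *)
Definition push (k : nat) (a : letter) : frag :=
  @Frag bool true (fun q r =>
    if q then (Some false, [ffun i : 'I_K.+1 =>
                 (r i, if i == k :> nat then MoveLeft else Stay)])
    else (None, act_on k (Some (inl a)) Stay r)).

Definition pop (k : nat) : frag :=
  @Frag unit tt (fun _ r => (None, act_on k None MoveRight r)).

Definition fseq (F G : frag) : frag :=
  @Frag (fstate F + fstate G)%type (inl (fstart F)) (fun q r =>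
    match q with
    | inl q => let: (q', act) := ftrans q r in
               (Some (if q' is Some q1 then inl q1 else inr (fstart G)), act)
    | inr q => let: (q', act) := ftrans q r in (omap inr q', act)
    end).

Definition branch (k : nat) (f : option letter -> frag) : frag :=
  @Frag (option {o : option letter & fstate (f o)}) None (fun q r =>
    match q with
    | None => let o := letter_of (r (inord k)) in
              (Some (Some (Tagged (fun o => fstate (f o)) (fstart (f o)))), idle r)
    | Some (existT o q) => let: (q', act) := ftrans q r in
        (omap (fun q1 => Some (Tagged (fun o => fstate (f o)) q1)) q', act)
    end).

Definition while (k : nat) (P : pred (option letter)) (F : frag) : frag :=
  @Frag (option (fstate F)) None (fun q r =>
    match q with
    | None => (if P (letter_of (r (inord k))) then Some (Some (fstart F)) else None,
               idle r)
    | Some q => let: (q', act) := ftrans q r in (Some q', act)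
    end).

Lemma frun_fseqr F G q tp n tp' :
  @frun G q tp n tp' -> @frun (fseq F G) (inr q) tp n tp'.
Proof.
elim=> [{}q {}tp act e|{}q q' {}tp act {}n {}tp' e _ IH].
  by apply: FrunExit; rewrite /= e.
by apply: FrunStep IH; rewrite /= e.
Qed.

Lemma frun_fseql F G q tp n tp' m tp'' :
  @frun F q tp n tp' -> frun (fstart G) tp' m tp'' ->
  @frun (fseq F G) (inl q) tp (n + m) tp''.
Proof.
elim=> [{}q {}tp act e|{}q q' {}tp act {}n {}tp' e _ IH] HG.
  by apply: FrunStep; [rewrite /= e|apply: frun_fseqr].
by rewrite addSn; apply: FrunStep (IH HG); rewrite /= e.
Qed.

Lemma frun_branch k f o q tp n tp' : @frun (f o) q tp n tp' ->
  @frun (branch k f) (Some (Tagged (fun o => fstate (f o)) q)) tp n tp'.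
Proof.
elim=> [{}q {}tp act e|{}q q' {}tp act {}n {}tp' e _ IH].
  by apply: FrunExit; rewrite /= e.
by apply: FrunStep IH; rewrite /= e.
Qed.

Lemma frun_while k P F q tp n tp' m tp'' : @frun F q tp n tp' ->
  @frun (while k P F) None tp' m tp'' ->
  @frun (while k P F) (Some q) tp (n + m) tp''.
Proof.
elim=> [{}q {}tp act e|{}q q' {}tp act {}n {}tp' e _ IH] HG.
  by rewrite add1n; apply: FrunStep HG; rewrite /= e.
by rewrite addSn; apply: FrunStep (IH HG); rewrite /= e.
Qed.

(* The cells to the left of the head are irrelevant: a push overwrites them. *)
Definition rep (tp : stape) (w : seq letter) : Prop :=
  exists j, scanned tp :: to_right tp =
            [seq Some (inl a) | a <- w] ++ nseq j (None : cell letter void).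

Definition reps (tp : stapes) (s : nat -> seq letter) : Prop :=
  forall i : 'I_K.+1, rep (tp i) (s i).

Definition upd (s : nat -> seq letter) k w : nat -> seq letter :=
  fun i => if i == k then w else s i.

Definition exec (F : frag) (n : nat) (s s' : nat -> seq letter) : Prop :=
  forall tp, reps tp s -> exists tp' k,
    [/\ k <= n, reps tp' s' & frun (fstart F) tp k tp'].

Lemma rep_top tp w : rep tp w -> letter_of (scanned tp) = ohead w.
Proof. by case: tp w => l c r [|a w] [[|j]] //= [-> _]. Qed.

Lemma reps_top (tp : stapes) s k : k <= K -> reps tp s ->
  letter_of (scan tp (inord k)) = ohead (s k).
Proof. by move=> lk /(_ (inord k)) /rep_top; rewrite ffunE inordK. Qed.

Lemma perform_idle tp : perform (idle (scan tp)) tp = tp.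
Proof. by apply/ffunP=> i; rewrite !ffunE /=; case: (tp i). Qed.

(** Stack contents are functions and are only ever equal pointwise. The rules below accordingly take
    the final contents up to [=1]. *)
Lemma exec_eq F n s1 s1' s2 s2' : s1 =1 s1' -> s2 =1 s2' ->
  exec F n s1 s2 -> exec F n s1' s2'.
Proof.
move=> e1 e2 H tp Htp; case: (H tp) => [i|tp' [k [lk Htp' run]]].
  by rewrite e1.
by exists tp', k; split=> // i; rewrite -e2; apply: Htp'.
Qed.

Lemma exec_weak F n m s s' : exec F n s s' -> n <= m -> exec F m s s'.
Proof.
move=> H le tp /H[tp' [k [lk Htp' run]]].
by exists tp', k; split=> //; apply: leq_trans le.
Qed.

Lemma exec_skip s s' : s' =1 s -> exec skip 1 s s'.
Proof.
move=> e; apply: (@exec_eq _ _ s s s) => // tp Htp; exists tp, 1; split=> //.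
rewrite -[X in frun _ _ _ X]perform_idle; exact: FrunExit.
Qed.

Lemma exec_push k a s s' : s' =1 upd s k (a :: s k) -> exec (push k a) 2 s s'.
Proof.
move=> e tp Htp.
pose act1 : acts := [ffun i : 'I_K.+1 =>
   (scan tp i, if i == k :> nat then MoveLeft else Stay)].
exists (perform (act_on k (Some (inl a)) Stay (scan (perform act1 tp)))
   (perform act1 tp)), 2; split=> // [i|]; last first.
  by apply: FrunStep; [|apply: FrunExit].
rewrite e /upd !ffunE; have [j] := Htp i.
rewrite /act_on /idle; case: (tp i) => l c r /= ej.
case: eqP => [<-|_] /=; last by exists j.
by exists j; rewrite /= ej.
Qed.

Lemma exec_pop k s s' : s' =1 upd s k (behead (s k)) -> exec (pop k) 1 s s'.
Proof.
move=> e tp Htp.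
exists (perform (act_on k None MoveRight (scan tp)) tp), 1; split=> // [i|].
  rewrite e /upd !ffunE; have [j] := Htp i.
  case: ifP => [/eqP ek|_]; rewrite /= /write; case: (tp i) => l c r /= ej.
    rewrite -ek; case: (s i) ej => [|b w] /=.
      case: j => //= j [_ ->]; case: j => [|j]; first by exists 1.
      by exists j.+1.
    case=> _ ->; case: w => [|b' w] /=; last by exists j.
    by case: j => [|j]; [exists 1|exists j.+1].
  by exists j.
by apply: FrunExit.
Qed.

Lemma exec_fseq F G n m s s' s'' :
  exec F n s s' -> exec G m s' s'' -> exec (fseq F G) (n + m) s s''.
Proof.
move=> HF HG tp /HF[tp' [k [lk /HG[tp'' [l [ll H'' rG]]] rF]]].
exists tp'', (k + l); split=> //; first exact: leq_add.
exact: frun_fseql rF rG.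
Qed.

Lemma exec_branch k f n s s' : k <= K ->
  exec (f (ohead (s k))) n s s' -> exec (branch k f) n.+1 s s'.
Proof.
move=> lk H tp Htp; have [tp' [l [ll Htp' run]]] := H tp Htp.
exists tp', l.+1; split=> //; apply: FrunStep; first by rewrite /= (reps_top lk Htp).
by rewrite perform_idle; apply: frun_branch.
Qed.

Lemma exec_while_stop k (P : pred (option letter)) F s s' : k <= K ->
  ~~ P (ohead (s k)) -> s' =1 s -> exec (while k P F) 1 s s'.
Proof.
move=> lk /negbTE H e; apply: (@exec_eq _ _ s s s) => // tp Htp.
exists tp, 1; split=> //.
rewrite -[X in frun _ _ _ X]perform_idle; apply: FrunExit.
by rewrite /= (reps_top lk Htp) H.
Qed.

Lemma exec_while_step k (P : pred (option letter)) F n m s s' s'' : k <= K -> P (ohead (s k)) ->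
  exec F n s s' -> exec (while k P F) m s' s'' ->
  exec (while k P F) (n + m).+1 s s''.
Proof.
move=> lk H HF HW tp Htp.
have [tp' [a [la Htp' ra]]] := HF tp Htp.
have [tp'' [b [lb Htp'' rb]]] := HW tp' Htp'.
exists tp'', (a + b).+1; split=> //; first by rewrite ltnS leq_add.
apply: FrunStep; first by rewrite /= (reps_top lk Htp) H.
by rewrite perform_idle; apply: frun_while rb.
Qed.

Definition machine_of (F : frag) : machine letter :=
  @Machine letter void K (option (fstate F)) (Some (fstart F))
    (fun q => q == None)
    (fun q r => if q is Some q then ftrans q r else (None, idle r)).

Lemma frun_machine F q tp n tp' : @frun F q tp n tp' ->
  iter n (@step letter (machine_of F)) (@Config letter (machine_of F) (Some q) tp) =
  @Config letter (machine_of F) None tp'.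
Proof.
elim=> [{}q {}tp act e|{}q q' {}tp act {}n {}tp' e _ IH].
  by rewrite /= /step /= e.
by rewrite iterSr -IH /step /= e.
Qed.

Lemma exec_outputs F n s s' w :
  s 0 = w -> (forall i, 0 < i -> s i = [::]) -> exec F n s s' ->
  outputs_within (machine_of F) w n (s' K).
Proof.
move=> s0 sS H.
case: (H [ffun i => tape_of_word void (if i == ord0 then w else [::])]) => [i|].
  rewrite ffunE; case: eqP => [->|ni].
    rewrite s0; case: w {s0} => [|a w]; first by exists 1.
    by exists 0; rewrite /= cats0.
  rewrite sS ?lt0n; first by exists 1.
  by apply/eqP=> i0; apply: ni; apply/val_inj.
move=> tp' [k [lk Htp' run]].
rewrite /outputs_within.
rewrite -(subnK lk) iterD (frun_machine run).
have -> : iter (n - k) (@step letter (machine_of F))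
  (@Config letter (machine_of F) None tp') = @Config letter (machine_of F) None tp'.
  by elim: (n - k) => //= m ->.
split=> //; have [j ej] := Htp' ord_max.
change (read_letters (scanned (tp' ord_max) :: to_right (tp' ord_max)) = s' K).
rewrite {}ej /=.
elim: (s' K) => [|a u IH] /=; first by case: j.
by rewrite IH.
Qed.

End Fragments.

Notation "F ;; G" := (fseq F G) (at level 60, right associativity).

(** * Arithmetic on binary words *)

Fixpoint word_val (w : seq bool) : nat :=
  if w is b :: w' then b + (word_val w').*2 else 0.

Section Combine.
Variable delta : bool -> bool -> bool -> bool * option bool.

Fixpoint pad_combine (q : bool) (b : seq bool) : seq bool :=
  if b is y :: b' then
    let: (q', o) := delta q false y in seq_of_opt o ++ pad_combine q' b'
  else nseq q true.

(* Runs a two-state transducer on the two words in parallel, the shorter one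
   being padded with zeros; a final state [true] emits one more digit 1. *)
Fixpoint combine (q : bool) (a b : seq bool) : seq bool :=
  if a is x :: a' then
    let: (q', o) := delta q x (head false b) in
    seq_of_opt o ++ combine q' a' (behead b)
  else pad_combine q b.

(** One round of the transducer in the form in which the machine performs it, treating both words
    alike. Two empty words are excluded because there the final state decides. *)
Lemma combineE q a b : ~~ (nilp a && nilp b) ->
  combine q a b = let: (q', o) := delta q (head false a) (head false b) in
    seq_of_opt o ++ combine q' (behead a) (behead b).
Proof. by case: a => //=; case: b. Qed.

Lemma size_combine q a b : size (combine q a b) <= (maxn (size a) (size b)).+1.
Proof.
elim: a q b => [|x a IH] q b /=.
  rewrite max0n; elim: b q => [|y b IHb] q /=; first by case: q.
  case: delta => q' o; rewrite size_cat; have := IHb q'; case: o => [?|] /=; lia.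
case: delta => q' o; rewrite size_cat; have := IH q' (behead b).
rewrite size_behead; case: o => [?|] /=; lia.
Qed.

End Combine.

(* Full adder: the state is the carry. *)
Definition add_delta (q x y : bool) : bool * option bool :=
  (2 <= q + x + y, Some (odd (q + x + y))).

(* The state tells whether the digits read so far satisfy [a <= b]. *)
Definition le_delta (q x y : bool) : bool * option bool :=
  (if x == y then q else y, None).

Definition add_word := combine add_delta false.
Definition le_word := combine le_delta true.

Lemma val_add_word a b : word_val (add_word a b) = word_val a + word_val b.
Proof.
suff H q : word_val (combine add_delta q a b) = q + word_val a + word_val b.
  by rewrite /add_word H.
elim: a q b => [|x a IH] q b /=.
  elim: b q => [|y b IHb] q /=; first by case: q.
  by rewrite IHb; case: q; case: y => /=; lia.
by rewrite IH; case: b => [|y b] /=; case: q; case: x; try case: y; rewrite /=; lia.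
Qed.

Lemma size_add_word a b : size (add_word a b) <= (maxn (size a) (size b)).+1.
Proof. exact: size_combine. Qed.

(** Digits come least significant first, so a later difference overrides the state and the initial
    state matters only for equal values. The result is at once a flag, testable by its first letter,
    and a number 0 or 1 that can be added. *)
Lemma le_wordE a b : le_word a b = nseq (word_val a <= word_val b) true.
Proof.
suff H q : combine le_delta q a b =
    nseq ((word_val a < word_val b) || (word_val a == word_val b) && q) true.
  by rewrite /le_word H andbT orbC -leq_eqVlt.
elim: a q b => [|x a IH] q b /=.
  elim: b q => [|y b IHb] q //=.
  by rewrite IHb; congr (nseq _ true); case: q; case: y; rewrite /=; lia.
rewrite IH; congr (nseq _ true).
by case: b => [|y b]; case: q; case: x; try case: y; rewrite /=; lia.
Qed.

Definition is_bit (o : option letter) : bool := if o is Some (Some _) then true else false.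

(** * Copying, discarding and combining words on stacks *)

Section Words.
Variable K : nat.

Notation frag := (frag K).
Notation skip := (skip K).
Notation push := (push K).
Notation pop := (pop K).

Definition push_opt (k : nat) (o : option letter) : frag :=
  if o is Some a then push k a else skip.

Definition copy_to i t : frag :=
  while i is_bit (branch i (push_opt t) ;; pop i).

Definition pour t j : frag :=
  while t isSome (branch t (push_opt j) ;; pop t).

Definition pour2 t i j : frag :=
  while t isSome (branch t (fun o => push_opt i o ;; push_opt j o) ;; pop t).

(** Copying to [t] reverses the digits and pouring back reverses them again. Only [j] needs a new
    separator, since the one on [i] stays in place. *)
Definition dup t i j : frag := copy_to i t ;; push j None ;; pour2 t i j.

Definition discard i : frag := while i is_bit (pop i) ;; pop i.

(* Tapes [t] and [f] hold the output digits in reverse and the state [q]; a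
   separator on [f] signals that both words are exhausted. *)
Definition combine_step delta t f i j (q a b : option letter) : frag :=
  if is_bit a || is_bit b then
    let: (q', o) := delta (odflt false (obind id q)) (odflt false (obind id a))
                          (odflt false (obind id b)) in
    (if is_bit a then pop i else skip) ;; (if is_bit b then pop j else skip) ;;
    pop f ;; push f (Some q') ;; push_opt t (omap some o)
  else pop i ;; pop j ;; pop f ;; push f None ;;
       (if odflt false (obind id q) then push t (Some true) else skip).

(** Pouring [t] above a fresh separator on [j] restores the order of the digits; the result thus
    replaces the second operand and the first one is consumed. *)
Definition combine_frag delta q0 t f i j : frag :=
  push f (Some q0) ;;
  while f is_bit (branch f (fun q => branch i (fun a => branch j (fun b =>
     combine_step delta t f i j q a b)))) ;;
  pop f ;; push j None ;; pour t j.

Notation bitl := (map (@Some bool)).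

Ltac upd_case :=
  move=> ?; rewrite /upd /=; repeat case: eqP => ?; subst; rewrite //=; try congruence.

Lemma exec_pour t j s s' u : t != j -> t <= K -> s t = u ->
  s' =1 upd (upd s t [::]) j (rev u ++ s j) ->
  exec (pour t j) (5 * size u).+1 s s'.
Proof.
move=> /eqP ntj lt; elim: u s s' => [|a u IH] s s' su e.
  apply: exec_while_stop; rewrite ?su // => x; rewrite e; move: x; upd_case.
apply: (@exec_weak _ _ ((3 + 1) + (5 * size u).+1).+1); last by rewrite /=; lia.
apply: (@exec_while_step _ _ _ _ _ _ _ (upd (upd s t u) j (a :: s j))) => //.
- by rewrite su.
- apply: (@exec_fseq _ _ _ _ _ _ (upd s j (a :: s j))).
    by apply: exec_branch => //; rewrite su; apply: exec_push.
  apply: exec_pop => x; move: x; upd_case; by rewrite su.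
- apply: IH => [|x]; first by rewrite /upd; repeat case: eqP => // ?; congruence.
  rewrite e rev_cons cat_rcons; move: x; upd_case.
Qed.

Lemma exec_copy_to i t s s' w r : t != i -> i <= K ->
  s i = bitl w ++ None :: r ->
  s' =1 upd (upd s i (None :: r)) t (rev (bitl w) ++ s t) ->
  exec (copy_to i t) (5 * size w).+1 s s'.
Proof.
move=> /eqP nti li; elim: w s s' => [|a w IH] s s' su e.
  apply: exec_while_stop; rewrite ?su // => x; rewrite e; move: x; upd_case.
apply: (@exec_weak _ _ ((3 + 1) + (5 * size w).+1).+1); last by rewrite /=; lia.
apply: (@exec_while_step _ _ _ _ _ _ _
  (upd (upd s i (bitl w ++ None :: r)) t (Some a :: s t))) => //.
- by rewrite su.
- apply: (@exec_fseq _ _ _ _ _ _ (upd s t (Some a :: s t))).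
    by apply: exec_branch => //; rewrite su; apply: exec_push.
  apply: exec_pop => x; move: x; upd_case; by rewrite su.
- apply: IH => [|x]; first by rewrite /upd; repeat case: eqP => // ?; congruence.
  rewrite e /= rev_cons cat_rcons; move: x; upd_case.
Qed.

Lemma exec_pour2 t i j s s' u : t != j -> t != i -> i != j -> t <= K -> s t = u ->
  s' =1 upd (upd (upd s t [::]) i (rev u ++ s i)) j (rev u ++ s j) ->
  exec (pour2 t i j) (7 * size u).+1 s s'.
Proof.
move=> /eqP ntj /eqP nti /eqP nij lt; elim: u s s' => [|a u IH] s s' su e.
  apply: exec_while_stop; rewrite ?su // => x; rewrite e; move: x; upd_case.
apply: (@exec_weak _ _ ((5 + 1) + (7 * size u).+1).+1); last by rewrite /=; lia.
apply: (@exec_while_step _ _ _ _ _ _ _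
  (upd (upd (upd s t u) i (a :: s i)) j (a :: s j))) => //.
- by rewrite su.
- apply: (@exec_fseq _ _ _ _ _ _ (upd (upd s i (a :: s i)) j (a :: s j))).
    apply: exec_branch => //; rewrite su.
    apply: (@exec_fseq _ _ _ 2 2 _ (upd s i (a :: s i))); first exact: exec_push.
    by apply: exec_push; upd_case.
  apply: exec_pop => x; move: x; upd_case; by rewrite su.
- apply: IH => [|x]; first by rewrite /upd; repeat case: eqP => // ?; congruence.
  rewrite e rev_cons !cat_rcons; move: x; upd_case.
Qed.

Lemma exec_dup t i j s s' w r : t != j -> t != i -> i != j -> t <= K -> i <= K ->
  s t = [::] -> s i = bitl w ++ None :: r ->
  s' =1 upd s j (bitl w ++ None :: s j) ->
  exec (dup t i j) (12 * size w + 4) s s'.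
Proof.
move=> ntj nti nij lt li st si e.
have [/eqP ntj' /eqP nti' /eqP nij'] := And3 ntj nti nij.
apply: (@exec_weak _ _ ((5 * size w).+1 + (2 + (7 * size w).+1))); last by lia.
apply: exec_fseq; first by apply: exec_copy_to si _.
apply: exec_fseq; first by apply: exec_push.
rewrite -(size_map (@Some bool) w) -(size_rev (bitl w)).
apply: exec_pour2 => //.
  by rewrite /upd; repeat case: eqP => // ?; rewrite ?st ?cats0; congruence.
rewrite revK => x; rewrite e; move: x; upd_case.
Qed.

Lemma exec_discard i s s' w r : i <= K -> s i = bitl w ++ None :: r ->
  s' =1 upd s i r -> exec (discard i) (2 * size w + 2) s s'.
Proof.
move=> li si e; apply: (@exec_weak _ _ ((2 * size w).+1 + 1)); last by lia.
apply: (@exec_fseq _ _ _ _ _ _ (upd s i (None :: r))); last first.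
  by apply: exec_pop => x; rewrite e; move: x; upd_case; rewrite /= eqxx.
elim: w s {s' e} si => [|a w IH] s si.
  apply: exec_while_stop; rewrite ?si //; upd_case.
apply: (@exec_weak _ _ (1 + (2 * size w).+1).+1); last by rewrite /=; lia.
apply: (@exec_while_step _ _ _ _ _ _ _ (upd s i (bitl w ++ None :: r))) => //.
- by rewrite si.
- by apply: exec_pop; upd_case; rewrite si.
- apply: (@exec_eq _ _ _ (upd s i (bitl w ++ None :: r))
    _ (upd (upd s i (bitl w ++ None :: r)) i (None :: r))) => //; first upd_case.
  by apply: IH; rewrite /upd eqxx.
Qed.

Lemma exec_combine_loop delta t f i j s s' q a b ra rb :
  uniq [:: t; f; i; j] -> f <= K -> i <= K -> j <= K ->
  s f = [:: Some q] -> s i = bitl a ++ None :: ra -> s j = bitl b ++ None :: rb ->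
  s' =1 upd (upd (upd (upd s i ra) j rb) f [:: None]) t
          (rev (bitl (combine delta q a b)) ++ s t) ->
  exec (while f is_bit (branch f (fun q => branch i (fun a => branch j (fun b =>
     combine_step delta t f i j q a b))))) (11 * (size a + size b) + 12) s s'.
Proof.
move=> /and5P[]; rewrite !inE !negb_or => /and3P[/eqP ntf /eqP nti /eqP ntj].
move=> /andP[/eqP nfi /eqP nfj] /eqP nij _ _ lf li lj.
(* Neither word need shrink in every round, so the induction is on the total length. *)
have [n] := ubnP (size a + size b); elim: n a b q s s' => // n IH a b q s s' ln.
move=> sf si sj e.
case: (boolP (nilp a && nilp b)) => [/andP[/nilP a0 /nilP b0]|nab].
  subst a b; apply: (@exec_weak _ _ (10 + 1).+1); last by [].
  apply: (@exec_while_step _ _ _ _ _ _ _ s') => //.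
  - by rewrite sf.
  - do 3![apply: exec_branch => //]; rewrite sf si sj /combine_step /=.
    apply: (@exec_weak _ _ (1 + (1 + (1 + (2 + 2))))); last by [].
    apply: exec_fseq; first exact: exec_pop.
    apply: exec_fseq; first exact: exec_pop.
    apply: exec_fseq; first exact: exec_pop.
    apply: exec_fseq; first exact: exec_push.
    case: q sf e => sf e.
      apply: exec_push => x; rewrite e /=; move: x; upd_case; rewrite ?sf ?si ?sj //.
    apply: (@exec_weak _ _ 1) => //.
    apply: exec_skip => x; rewrite e /=; move: x; upd_case; rewrite ?sf ?si ?sj //.
  - apply: exec_while_stop => //.
    by rewrite e /upd eqxx; case: eqP => // /esym.
rewrite combineE // in e.
case ed: (delta q (head false a) (head false b)) => [q' o].
rewrite ed in e.
(* A round costs three branchings, at most seven steps of stack operations and one loop test, and it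
   consumes at least one digit: hence 11 per digit. *)
apply: (@exec_weak _ _ (10 + (11 * (size (behead a) + size (behead b)) + 12)).+1); last first.
  by case: a b nab {ln si sj e ed} => [|x a] [|y b] //= _; lia.
pose s1 := upd (upd (upd (upd s i (bitl (behead a) ++ None :: ra))
  j (bitl (behead b) ++ None :: rb)) f [:: Some q']) t (bitl (seq_of_opt o) ++ s t).
apply: (@exec_while_step _ _ _ _ _ _ _ s1) => //.
- by rewrite sf.
- do 3![apply: exec_branch => //]; rewrite sf si sj /combine_step.
  have -> : is_bit (ohead (bitl a ++ None :: ra)) = ~~ nilp a by case: (a).
  have -> : is_bit (ohead (bitl b ++ None :: rb)) = ~~ nilp b by case: (b).
  rewrite -negb_and nab /=.
  have -> : odflt false (obind id (ohead (bitl a ++ None :: ra))) = head false a.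
    by case: (a).
  have -> : odflt false (obind id (ohead (bitl b ++ None :: rb))) = head false b.
    by case: (b).
  rewrite ed; apply: (@exec_weak _ _ (1 + (1 + (1 + (2 + 2))))); last by [].
  apply: (@exec_fseq _ _ _ _ _ _ (upd s i (bitl (behead a) ++ None :: ra))).
    case: (a) si => [|x a'] si /=; first by apply: exec_skip; upd_case.
    by apply: exec_pop; upd_case; rewrite si.
  apply: (@exec_fseq _ _ _ _ _ _ (upd (upd s i (bitl (behead a) ++ None :: ra))
    j (bitl (behead b) ++ None :: rb))).
    case: (b) sj => [|y b'] sj /=; first by apply: exec_skip; upd_case.
    by apply: exec_pop; upd_case; rewrite sj.
  apply: exec_fseq; first exact: exec_pop.
  apply: exec_fseq; first exact: exec_push.
  case: o ed e @s1 => [o|] ed e /=.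
    by apply: exec_push; upd_case; rewrite sf.
  apply: (@exec_weak _ _ 1) => //.
  by apply: exec_skip; upd_case; rewrite sf.
apply: IH.
- by case: a b nab ln {si sj e ed s1} => [|x a] [|y b] //= _; lia.
- by rewrite /s1 /upd; repeat case: eqP => // ?; congruence.
- by rewrite /s1 /upd; repeat case: eqP => // ?; congruence.
- by rewrite /s1 /upd; repeat case: eqP => // ?; congruence.
move=> x; rewrite e map_cat rev_cat -catA.
have -> : rev (bitl (seq_of_opt o)) = bitl (seq_of_opt o) by case: (o).
rewrite /s1; move: x; upd_case.
Qed.

Lemma exec_combine delta q0 t f i j s s' a b ra rb :
  uniq [:: t; f; i; j] -> t <= K -> f <= K -> i <= K -> j <= K ->
  s t = [::] -> s f = [::] ->
  s i = bitl a ++ None :: ra -> s j = bitl b ++ None :: rb ->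
  s' =1 upd (upd s i ra) j (bitl (combine delta q0 a b) ++ None :: rb) ->
  exec (combine_frag delta q0 t f i j) (16 * (size a + size b) + 30) s s'.
Proof.
move=> u lt lf li lj st sf si sj e.
have /and5P[] := u; rewrite !inE !negb_or => /and3P[/eqP ntf /eqP nti /eqP ntj].
move=> /andP[/eqP nfi /eqP nfj] /eqP nij _ _.
set c := combine delta q0 a b in e *.
apply: (@exec_weak _ _ (2 + ((11 * (size a + size b) + 12) + (1 + (2 + (5 * size c).+1)))));
  last first.
  by have := size_combine delta q0 a b; rewrite -/c; lia.
apply: exec_fseq; first exact: exec_push.
apply: exec_fseq.
  apply: (@exec_combine_loop _ _ _ _ _ _ _ q0 a b ra rb) (fun _ => erefl) => //.
  - by rewrite /upd eqxx sf.
  - by rewrite -si /upd; repeat case: eqP => // ?; congruence.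
  - by rewrite -sj /upd; repeat case: eqP => // ?; congruence.
apply: exec_fseq; first exact: exec_pop.
apply: exec_fseq; first exact: exec_push.
rewrite -/c -(size_map (@Some bool) c) -(size_rev (bitl c)).
apply: exec_pour => //; first exact/eqP.
  by rewrite /upd; repeat case: eqP => // ?; rewrite ?st ?cats0; congruence.
rewrite revK => x; rewrite e; move: x; upd_case.
Qed.

End Words.

Notation frag16 := (frag 15).
Notation while16 := (@while 15).
Notation branch16 := (@branch 15).

(** * Stacks of words *)

Definition enc_words (s : seq (seq bool)) : seq letter :=
  flatten [seq rcons [seq Some b | b <- w] None | w <- s].

Definition letters (W : seq (seq (seq bool))) : nat -> seq letter :=
  fun k => enc_words (nth [::] W k).

Definition short (B : nat) (W : seq (seq (seq bool))) : Prop :=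
  forall k w, w \in nth [::] W k -> size w <= B.

(* Bounds the running time of one [dup], [discard] or [combine_frag] on words of
   size at most [B]; running times below are counted in these units. *)
Definition cost_unit (B : nat) : nat := 40 * B + 40.

(** The step bound makes sense only while all words stay within [B]; shortness is both premise and
    conclusion so that it passes along compositions. *)
Definition wexec (B : nat) (F : frag16) (n : nat) (W W' : seq (seq (seq bool))) :
    Prop :=
  short B W -> exec F (n * cost_unit B) (letters W) (letters W') /\ short B W'.

Lemma letters_set_nth W k s : letters (set_nth [::] W k s) =1 upd (letters W) k (enc_words s).
Proof. by move=> i; rewrite /letters /upd nth_set_nth /=; case: eqP. Qed.

Lemma enc_words_cons w s : enc_words (w :: s) = [seq Some b | b <- w] ++ None :: enc_words s.
Proof. by rewrite /enc_words /= cat_rcons. Qed.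

Lemma short_set_nth B W k s :
  short B W -> (forall w, w \in s -> size w <= B) -> short B (set_nth [::] W k s).
Proof. by move=> H Hs i w; rewrite nth_set_nth /=; case: eqP => [_ /Hs|_ /H]. Qed.

Section Wexec.
Variable B : nat.

Lemma wexec_weak F n m W W' : wexec B F n W W' -> n <= m -> wexec B F m W W'.
Proof.
move=> H le /H[He Hs]; split=> //; apply: exec_weak He _.
by rewrite leq_mul2r le orbT.
Qed.

Lemma wexec_fseq F G n m W W' W'' :
  wexec B F n W W' -> wexec B G m W' W'' -> wexec B (F ;; G) (n + m) W W''.
Proof.
move=> HF HG /HF[eF /HG[eG s]]; split=> //.
by rewrite mulnDl; apply: exec_fseq eF eG.
Qed.

Lemma wexec_branch k f n W W' : k <= 15 ->
  wexec B (f (ohead (letters W k))) n W W' -> wexec B (branch k f) n.+1 W W'.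
Proof.
move=> lk H /H[e s]; split=> //; apply: exec_weak (exec_branch lk e) _.
by rewrite mulSn /cost_unit; lia.
Qed.

Lemma wexec_while_stop k P (F : frag16) W : k <= 15 ->
  ~~ P (ohead (letters W k)) -> wexec B (while k P F) 1 W W.
Proof.
move=> lk H s; split=> //; apply: exec_weak (exec_while_stop _ lk H (fun _ => erefl)) _.
by rewrite /cost_unit; lia.
Qed.

Lemma wexec_while_step k (P : pred (option letter)) (F : frag16) n m W W' W'' : k <= 15 ->
  P (ohead (letters W k)) -> wexec B F n W W' -> wexec B (while k P F) m W' W'' ->
  wexec B (while k P F) (n + m).+1 W W''.
Proof.
move=> lk H HF HG /HF[eF /HG[eG s]]; split=> //.
apply: exec_weak (exec_while_step lk H eF eG) _.
by rewrite /cost_unit; lia.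
Qed.

Lemma wexec_loop_stop k (F : frag16) W : k <= 15 ->
  nth [::] W k = [::] -> wexec B (while k isSome F) 1 W W.
Proof. by move=> lk H; apply: wexec_while_stop => //; rewrite /letters H. Qed.

Lemma wexec_loop_step k (F : frag16) n m W W' W'' w s : k <= 15 ->
  nth [::] W k = w :: s -> wexec B F n W W' -> wexec B (while k isSome F) m W' W'' ->
  wexec B (while k isSome F) (n + m).+1 W W''.
Proof.
move=> lk H HF HG; apply: wexec_while_step HF HG => //.
by rewrite /letters H enc_words_cons; case: (w).
Qed.

(** A separator with no digit above it is the empty word, so this pushes the number 0. *)
Lemma wexec_push_sep k W :
  wexec B (push 15 k None) 1 W (set_nth [::] W k ([::] :: nth [::] W k)).
Proof.
move=> s; split; last first.
  by apply: short_set_nth => // w; rewrite inE => /predU1P[->|/s].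
apply: (@exec_weak _ _ 2); last by rewrite /cost_unit; lia.
by apply: exec_push => i; rewrite letters_set_nth.
Qed.

Lemma wexec_push_bit k b W w s : nth [::] W k = w :: s -> size w < B ->
  wexec B (push 15 k (Some b)) 1 W (set_nth [::] W k ((b :: w) :: s)).
Proof.
move=> e lt H; split; last first.
  apply: short_set_nth => // u; rewrite inE => /predU1P[->//|us].
  by apply: (H k); rewrite e inE us orbT.
apply: (@exec_weak _ _ 2); last by rewrite /cost_unit; lia.
by apply: exec_push => i; rewrite letters_set_nth /letters e.
Qed.

Lemma wexec_pop_bit k b W w s : nth [::] W k = (b :: w) :: s ->
  wexec B (pop 15 k) 1 W (set_nth [::] W k (w :: s)).
Proof.
move=> e H; split; last first.
  apply: short_set_nth => // u; rewrite inE => /predU1P[->|us].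
    by apply: ltnW; apply: (H k (b :: w)); rewrite e inE eqxx.
  by apply: (H k); rewrite e inE us orbT.
apply: (@exec_weak _ _ 1); last by rewrite /cost_unit; lia.
by apply: exec_pop => i; rewrite letters_set_nth /letters e.
Qed.

Lemma wexec_discard k W w s : k <= 15 -> nth [::] W k = w :: s ->
  wexec B (discard 15 k) 1 W (set_nth [::] W k s).
Proof.
move=> lk e H; split; last first.
  by apply: short_set_nth => // u us; apply: (H k); rewrite e inE us orbT.
have lw : size w <= B by apply: (H k); rewrite e inE eqxx.
apply: (@exec_weak _ _ (2 * size w + 2)); last by rewrite /cost_unit; lia.
apply: (@exec_discard _ _ _ _ w (enc_words s)) => // [|i].
  by rewrite /letters e enc_words_cons.
by rewrite letters_set_nth.
Qed.

Lemma wexec_dup i j W w s : [&& 13 != i, 13 != j, i != j & i <= 15] ->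
  nth [::] W 13 = [::] -> nth [::] W i = w :: s ->
  wexec B (dup 15 13 i j) 1 W (set_nth [::] W j (w :: nth [::] W j)).
Proof.
move=> /and4P[ni nj nij li] e13 e H.
have lw : size w <= B by apply: (H i); rewrite e inE eqxx.
split; last first.
  by apply: short_set_nth => // u; rewrite inE => /predU1P[->//|/H].
apply: (@exec_weak _ _ (12 * size w + 4)); last by rewrite /cost_unit; lia.
apply: (@exec_dup _ _ _ _ _ _ w (enc_words s)) => // [||x].
- by rewrite /letters e13.
- by rewrite /letters e enc_words_cons.
by rewrite letters_set_nth enc_words_cons.
Qed.

Definition mov i j : frag16 := dup 15 13 i j ;; discard 15 i.

Lemma wexec_mov i j W w s : [&& 13 != i, 13 != j, i != j & i <= 15] ->
  nth [::] W 13 = [::] -> nth [::] W i = w :: s ->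
  wexec B (mov i j) 2 W (set_nth [::] (set_nth [::] W j (w :: nth [::] W j)) i s).
Proof.
move=> ok e13 e; apply: wexec_fseq (wexec_dup ok e13 e) _.
have /and4P[_ _ /negbTE nij li] := ok.
by apply: (@wexec_discard _ _ w) => //; rewrite nth_set_nth /= nij.
Qed.

Lemma wexec_combine delta q0 i j W a b sa sb :
  [&& uniq [:: 13; 14; i; j], i <= 15 & j <= 15] ->
  nth [::] W 13 = [::] -> nth [::] W 14 = [::] ->
  nth [::] W i = a :: sa -> nth [::] W j = b :: sb -> (maxn (size a) (size b)).+1 <= B ->
  wexec B (combine_frag 15 delta q0 13 14 i j) 1 W
    (set_nth [::] (set_nth [::] W i sa) j (combine delta q0 a b :: sb)).
Proof.
move=> /and3P[u li lj] e13 e14 ei ej lB H.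
split; last first.
  apply: short_set_nth => [|w].
    by apply: short_set_nth => // w us; apply: (H i); rewrite ei inE us orbT.
  rewrite inE => /predU1P[->|us]; last by apply: (H j); rewrite ej inE us orbT.
  exact: leq_trans (size_combine _ _ _ _) lB.
apply: (@exec_weak _ _ (16 * (size a + size b) + 30)).
  apply: (@exec_combine _ _ _ _ _ _ _ _ _ a b (enc_words sa) (enc_words sb)) => //.
  - by rewrite /letters e13.
  - by rewrite /letters e14.
  - by rewrite /letters ei enc_words_cons.
  - by rewrite /letters ej enc_words_cons.
  move=> x; rewrite letters_set_nth enc_words_cons /upd.
  by case: eqP => // _; rewrite letters_set_nth.
by rewrite /cost_unit; lia.
Qed.

Definition add_frag i j : frag16 := combine_frag 15 add_delta false 13 14 i j.
Definition le_frag i j : frag16 := combine_frag 15 le_delta true 13 14 i j.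

End Wexec.

(** Configurations are kept as explicit lists of sixteen stacks, so the [set_nth] left by each rule
    computes away and the side conditions close by reflexivity. *)
Ltac wsimpl :=
  lazymatch goal with
  | |- wexec ?B ?F ?n ?W ?W' =>
    let W1 := eval cbn [set_nth nth] in W in change (wexec B F n W1 W')
  end.

Ltac wbase :=
  first
  [ apply: wexec_dup; reflexivity
  | apply: wexec_mov; reflexivity
  | apply: wexec_discard; reflexivity
  | apply: wexec_push_sep
  | apply: wexec_pop_bit; reflexivity
  | apply: wexec_loop_stop; reflexivity ].

Ltac wstep :=
  lazymatch goal with
  | |- wexec _ (fseq _ _) _ _ _ => apply: wexec_fseq; [wbase | wsimpl]
  | |- _ => wbase
  end.

(** * Multiplication *)

Definition mul_loop : frag16 :=
  while 10 is_bit
    (branch 10 (fun o =>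
       if o == Some (Some true) then pop 15 10 ;; dup 15 13 11 10 ;; add_frag 10 12
       else pop 15 10) ;;
     push 15 11 (Some false)).

Definition mul_frag : frag16 :=
  push 15 12 None ;; mul_loop ;; discard 15 10 ;; discard 15 11.

(** Schoolbook shift and add: each digit of [a] may add [b] to [z], and pushing a low digit 0
    doubles [b]. The invariant [size z <= (size b).+1] survives because an addition lengthens [z] to
    at most [(size b).+2] while [b] itself gains a digit. *)
Lemma wexec_mul_loop B a b z s0 s1 s2 s3 s4 s5 s6 s7 s8 s9 s10 s11 s12 s15 :
  size z <= (size b).+1 -> size a + size b + 2 <= B ->
  exists b' z', [/\ word_val z' = word_val z + word_val a * word_val b,
    size z' <= size a + size b + 1 &
    wexec B mul_loop (6 * size a + 1)
      [:: s0; s1; s2; s3; s4; s5; s6; s7; s8; s9; a :: s10; b :: s11; z :: s12;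
          [::]; [::]; s15]
      [:: s0; s1; s2; s3; s4; s5; s6; s7; s8; s9; [::] :: s10; b' :: s11; z' :: s12;
          [::]; [::]; s15]].
Proof.
elim: a b z => [|x a IH] b z lz lB.
  exists b, z; split; rewrite /= ?mul0n ?addn0 ?add0n ?addn1 //.
  exact: wexec_while_stop.
case: (IH (false :: b) (if x then add_word b z else z)); rewrite /= in lB *.
- by case: (x); have := size_add_word b z; lia.
- by lia.
move=> b' [z' [ez lz' H]]; exists b', z'; split.
- rewrite ez; case: (x); rewrite ?val_add_word /=; lia.
- by move: lz'; rewrite /=; lia.
apply: (@wexec_weak _ _ (5 + (6 * size a + 1)).+1); last by lia.
apply: wexec_while_step H => //; rewrite /mul_loop.
apply: (@wexec_fseq _ _ _ 4 1 _ [:: s0; s1; s2; s3; s4; s5; s6; s7; s8; s9; a :: s10;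
  b :: s11; (if x then add_word b z else z) :: s12; [::]; [::]; s15]); last first.
  by apply: wexec_push_bit; [reflexivity|lia].
apply: wexec_branch => //; rewrite /=.
case: (x) => /=.
  apply: (@wexec_weak _ _ (1 + (1 + 1))); last by [].
  wstep; wstep; apply: wexec_combine => //; rewrite /=; lia.
apply: (@wexec_weak _ _ 1) => //; wstep.
Qed.

Lemma wexec_mul B a b s0 s1 s2 s3 s4 s5 s6 s7 s8 s9 s10 s11 s12 s15 :
  size a + size b + 2 <= B ->
  exists z, [/\ word_val z = word_val a * word_val b,
    size z <= size a + size b + 1 &
    wexec B mul_frag (6 * size a + 4)
      [:: s0; s1; s2; s3; s4; s5; s6; s7; s8; s9; a :: s10; b :: s11; s12;
          [::]; [::]; s15]
      [:: s0; s1; s2; s3; s4; s5; s6; s7; s8; s9; s10; s11; z :: s12;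
          [::]; [::]; s15]].
Proof.
move=> lB.
have [|b' [z [ez lz H]]] := @wexec_mul_loop B a b [::] s0 s1 s2 s3 s4 s5 s6 s7 s8 s9
  s10 s11 s12 s15 _ lB; first by [].
exists z; split=> //.
apply: (@wexec_weak _ _ (1 + ((6 * size a + 1) + (1 + 1)))); last by lia.
rewrite /mul_frag; wstep; apply: wexec_fseq H _; wstep; wstep.
Qed.

(** * The algorithm *)

(* Tapes during the computation: 0 TAs still to be processed; 1 reversed input,
   then the numerator of the grade of the current TA on top; 2 tally of parsed TAs,
   then the rank of the current TA; 3 all TAs; 4 capacity; 5 threshold, with the
   value of the current TA on top; 6 TAs already compared with the current one;
   7 denominator of the current grade; 8 total value and 9 number of the TAs
   selected so far; 10, 11 operands; 12 products; 13 scratch; 14 transducer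
   state; 15 output. *)
Definition compare : frag16 :=
  branch16 3 (fun o => if is_bit o then
    mov 3 6 ;; dup 15 13 3 10 ;; mov 3 6 ;; dup 15 13 1 11 ;; mul_frag ;;
    dup 15 13 3 10 ;; mov 3 6 ;; dup 15 13 7 11 ;; mul_frag ;;
    mov 12 10 ;; le_frag 12 10 ;; add_frag 10 2
  else mov 3 6 ;; mov 3 6 ;; mov 3 6).

(** The test is [num / den <= n' / d'] cleared of denominators, and its result is added to the rank
    as it stands. As that word has at most one digit, the bound with [maxn 1] grows by only one per
    comparison when iterated. *)
Lemma wexec_compare B N num den v' d' n' r s0 s1 s2 s3 s4 s5 s6 s7 s8 s9 s10 s11 s12 s15 :
  size num <= N -> size den <= N -> size d' <= N -> size n' <= N ->
  2 * N + size r + 5 <= B ->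
  exists r', [/\ word_val r' = word_val r +
       (~~ nilp v' && (word_val d' * word_val num <= word_val n' * word_val den)),
    size r' <= (size r).+2 /\ size r' <= (maxn 1 (size r)).+1 &
    wexec B compare (12 * N + 30)
      [:: s0; num :: s1; r :: s2; [:: v', d', n' & s3]; s4; s5; s6; den :: s7; s8; s9;
          s10; s11; s12; [::]; [::]; s15]
      [:: s0; num :: s1; r' :: s2; s3; s4; s5; [:: n', d', v' & s6]; den :: s7; s8; s9;
          s10; s11; s12; [::]; [::]; s15]].
Proof.
move=> lnum lden ld ln lB.
case: v' => [|x v] /=.
  exists r; split; [by rewrite addn0|by lia|].
  apply: (@wexec_weak _ _ (2 + (2 + 2)).+1); last by lia.
  by apply: wexec_branch => //=; wstep; wstep; wstep.
have [|z1 [ez1 lz1 H1]] := @wexec_mul B d' num s0 (num :: s1) (r :: s2) (n' :: s3) s4 s5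
  [:: d', x :: v & s6] (den :: s7) s8 s9 s10 s11 s12 s15 _; first by lia.
have [|z2 [ez2 lz2 H2]] := @wexec_mul B n' den s0 (num :: s1) (r :: s2) s3 s4 s5
  [:: n', d', x :: v & s6] (den :: s7) s8 s9 s10 s11 (z1 :: s12) s15 _; first by lia.
have le1 : size (le_word z1 z2) <= 1 by rewrite le_wordE size_nseq leq_b1.
exists (add_word (le_word z1 z2) r); split.
- by rewrite val_add_word addnC le_wordE -ez1 -ez2; case: (_ <= _).
- by have := size_add_word (le_word z1 z2) r; lia.
apply: wexec_weak; [apply: wexec_branch => //=|].
  do 4![wstep]; apply: wexec_fseq H1 _.
  do 3![wstep]; apply: wexec_fseq H2 _.
  wstep.
  apply: wexec_fseq.
    by apply: wexec_combine; [done|reflexivity|reflexivity|reflexivity|reflexivity|lia].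
  wsimpl.
  by apply: wexec_combine; [done|reflexivity|reflexivity|reflexivity|reflexivity|
     rewrite -/(le_word z1 z2); lia].
by lia.
Qed.

Lemma wexec_eq B F n W1 W1' W2 W2' :
  (forall k, nth [::] W1 k = nth [::] W1' k) -> (forall k, nth [::] W2 k = nth [::] W2' k) ->
  wexec B F n W1 W2 -> wexec B F n W1' W2'.
Proof.
move=> e1 e2 H s; case: H => [k w|He s2]; first by rewrite e1; apply: s.
split; last by move=> k w; rewrite -e2; apply: s2.
by apply: exec_eq He => k; rewrite /letters (e1, e2).
Qed.

Definition mov_all i j : frag16 := while16 i isSome (mov i j).

Lemma wexec_mov_all B i j W : [&& 13 != i, 13 != j, i != j & i <= 15] ->
  nth [::] W 13 = [::] ->
  wexec B (mov_all i j) (3 * size (nth [::] W i) + 1) W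
    (set_nth [::] (set_nth [::] W j (rev (nth [::] W i) ++ nth [::] W j)) i [::]).
Proof.
move=> ok; have /and4P[/eqP ni /eqP nj /eqP nij li] := ok.
move es: (nth [::] W i) => s; elim: s W es => [|w s IH] W es e13.
  apply: (@wexec_eq _ _ _ W _ W); [by []| |exact: wexec_loop_stop es] => k.
  rewrite nth_set_nth /=; case: eqP => [->//|_].
  by rewrite nth_set_nth /=; case: eqP => [->|].
apply: (@wexec_weak _ _ (2 + (3 * size s + 1)).+1); last by rewrite /=; lia.
apply: (wexec_loop_step li es (@wexec_mov _ _ _ _ _ _ ok e13 es)).
apply: (wexec_eq _ _ (IH _ _ _)) => // [k||].
- do 4![rewrite !nth_set_nth /=]; rewrite eqxx.
  case: (k =P i) => // _; case: (k =P j) => // _.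
  by case: (j =P i) => [/esym//|_]; rewrite rev_cons cat_rcons.
- by rewrite nth_set_nth /= eqxx.
rewrite nth_set_nth /=; case: eqP => // _.
by rewrite nth_set_nth /=; case: eqP.
Qed.

(** The comparisons leave all records on tape 6 in reverse, fields included; moving every word back
    restores tape 3 for the next TA. *)
Definition rank_frag : frag16 :=
  push 15 2 None ;; while16 3 isSome compare ;; mov_all 6 3.

(* A word of value 0 is empty, so testing its first letter for being a bit tests
   it for being nonzero; this applies to the encoded utilities, which have no
   superfluous zeros, and to the results [nseq b true] of comparisons. *)
Definition process : frag16 :=
  mov 0 5 ;; mov 0 7 ;; mov 0 1 ;; rank_frag ;; discard 15 7 ;; discard 15 1 ;;
  branch16 5 (fun o => if is_bit o then
    dup 15 13 4 10 ;; le_frag 2 10 ;;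
    branch16 10 (fun o => if is_bit o then
      dup 15 13 10 15 ;; add_frag 10 9 ;; add_frag 5 8
    else mov 10 15 ;; discard 15 5)
  else discard 15 2 ;; mov 5 15).

Section Records.
Variables (T : Type) (v d n : T -> seq bool).

Definition records (ts : seq T) : seq (seq bool) :=
  flatten [seq [:: v t; d t; n t] | t <- ts].

(** Reads [n t / d t <= n t' / d t']: it is the second argument that does at least as well as the
    first. *)
Definition beats (t t' : T) : bool :=
  ~~ nilp (v t') && (word_val (d t') * word_val (n t) <= word_val (n t') * word_val (d t)).

Lemma size_records ts : size (records ts) = 3 * size ts.
Proof. by elim: ts => //= t ts ->; rewrite mulnS. Qed.

Lemma wexec_rank_loop B N t ts r s0 s1 s2 s4 s5 s6 s7 s8 s9 s10 s11 s12 s15 :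
  (forall t, [/\ size (v t) <= N, size (d t) <= N & size (n t) <= N]) ->
  2 * N + maxn 1 (size r) + size ts + 5 <= B ->
  exists r', [/\ word_val r' = word_val r + count (beats t) ts,
    size r' <= maxn 1 (size r) + size ts &
    wexec B (while16 3 isSome compare) ((12 * N + 31) * size ts + 1)
      [:: s0; n t :: s1; r :: s2; records ts; s4; s5; s6; d t :: s7; s8; s9;
          s10; s11; s12; [::]; [::]; s15]
      [:: s0; n t :: s1; r' :: s2; [::]; s4; s5; rev (records ts) ++ s6; d t :: s7; s8; s9;
          s10; s11; s12; [::]; [::]; s15]].
Proof.
move=> lN; elim: ts r s6 => [|t' ts IH] r s6 lB.
  exists r; split; [by rewrite addn0|by lia|].
  by apply: (@wexec_weak _ _ 1); [wstep|lia].
have [_ ld1 ln1] := lN t; have [_ ld2 ln2] := lN t'.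
rewrite /= in lB.
have [|r1 [e1 [l1 l1'] H1]] := @wexec_compare B N (n t) (d t) (v t') (d t') (n t') r s0 s1 s2
  (records ts) s4 s5 s6 s7 s8 s9 s10 s11 s12 s15 ln1 ld1 ld2 ln2; first by lia.
have [|r2 [e2 l2 H2]] := IH r1 [:: n t', d t', v t' & s6]; first by lia.
exists r2; split.
- by rewrite e2 e1 /= -addnA.
- by rewrite /=; lia.
apply: (@wexec_weak _ _ ((12 * N + 30) + ((12 * N + 31) * size ts + 1)).+1); last first.
  by rewrite /= mulnS; lia.
apply: (@wexec_loop_step B 3 _ _ _ _ _ _ (v t') [:: d t', n t' & records ts] _ _ H1) => //.
have -> : rev (records (t' :: ts)) ++ s6 = rev (records ts) ++ [:: n t', d t', v t' & s6].
  by rewrite /records /= !rev_cons !cat_rcons.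
exact: H2.
Qed.

Lemma wexec_rank B N t ts s0 s1 s2 s4 s5 s7 s8 s9 s10 s11 s12 s15 :
  (forall t, [/\ size (v t) <= N, size (d t) <= N & size (n t) <= N]) ->
  2 * N + size ts + 6 <= B ->
  exists r, [/\ word_val r = count (beats t) ts,
    size r <= (size ts).+1 &
    wexec B rank_frag ((12 * N + 40) * size ts + 3)
      [:: s0; n t :: s1; s2; records ts; s4; s5; [::]; d t :: s7; s8; s9;
          s10; s11; s12; [::]; [::]; s15]
      [:: s0; n t :: s1; r :: s2; records ts; s4; s5; [::]; d t :: s7; s8; s9;
          s10; s11; s12; [::]; [::]; s15]].
Proof.
move=> lN lB.
have [|r [er lr H]] := @wexec_rank_loop B N t ts [::] s0 s1 s2 s4 s5 [::] s7 s8 s9 s10 s11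
  s12 s15 lN; first by rewrite /=; lia.
exists r; split=> //.
apply: wexec_weak.
  rewrite /rank_frag; wstep; apply: wexec_fseq H _.
  have := @wexec_mov_all B 6 3 [:: s0; n t :: s1; r :: s2; [::]; s4; s5;
     rev (records ts) ++ [::]; d t :: s7; s8; s9; s10; s11; s12; [::]; [::]; s15] isT erefl.
  by rewrite /= !cats0 revK; apply.
by rewrite size_rev size_records; lia.
Qed.

Variables (ts : seq T) (c : seq bool).

Definition selected (t : T) : bool :=
  ~~ nilp (v t) && (count (beats t) ts <= word_val c).

Lemma wexec_process B N t S C s0 s1 s2 s4 s5 s7 s8 s9 s10 s11 s12 s15 :
  (forall t, [/\ size (v t) <= N, size (d t) <= N & size (n t) <= N]) ->
  size c <= N -> 2 * N + size ts + size S + size C + 6 <= B ->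
  exists S' C', [/\ word_val S' = word_val S + selected t * word_val (v t),
    word_val C' = word_val C + selected t,
    size S' <= (maxn N (size S)).+1 /\ size C' <= (maxn 1 (size C)).+1 &
    wexec B process ((12 * N + 40) * size ts + 30)
      [:: [:: v t, d t, n t & s0]; s1; s2; records ts; c :: s4; s5; [::]; s7; S :: s8; C :: s9;
          s10; s11; s12; [::]; [::]; s15]
      [:: s0; s1; s2; records ts; c :: s4; s5; [::]; s7; S' :: s8; C' :: s9;
          s10; s11; s12; [::]; [::]; nseq (selected t) true :: s15]].
Proof.
move=> lN lc lB.
have [lv ld ln] := lN t.
have [|r [er lr H]] := @wexec_rank B N t ts s0 s1 s2 (c :: s4) (v t :: s5) s7 (S :: s8)
   (C :: s9) s10 s11 s12 s15 lN; first by lia.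
set W0 := (W in wexec B _ _ W _) in H *.
suff [S' [C' [eS eC lSC H']]] : exists S' C', [/\
    word_val S' = word_val S + selected t * word_val (v t),
    word_val C' = word_val C + selected t,
    size S' <= (maxn N (size S)).+1 /\ size C' <= (maxn 1 (size C)).+1 &
    wexec B (branch16 5 (fun o => if is_bit o then
    dup 15 13 4 10 ;; le_frag 2 10 ;;
    branch16 10 (fun o => if is_bit o then
      dup 15 13 10 15 ;; add_frag 10 9 ;; add_frag 5 8
    else mov 10 15 ;; discard 15 5)
  else discard 15 2 ;; mov 5 15)) 10
      [:: s0; s1; r :: s2; records ts; c :: s4; v t :: s5; [::]; s7; S :: s8; C :: s9;
          s10; s11; s12; [::]; [::]; s15]
      [:: s0; s1; s2; records ts; c :: s4; s5; [::]; s7; S' :: s8; C' :: s9;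
          s10; s11; s12; [::]; [::]; nseq (selected t) true :: s15]].
  exists S', C'; split=> //; apply: wexec_weak.
    rewrite /process; do 3![wstep]; apply: wexec_fseq H _; do 2![wstep]; exact: H'.
  by lia.
have [sel|nsel] := boolP (selected t); last first.
  exists S, C; split; rewrite ?mul0n ?addn0 //; first by lia.
  move: nsel; rewrite /selected; case ev: (v t) => [|x w] /= nsel.
    (* The value word is empty here, so moving it to the output writes the answer 0. *)
    apply: (@wexec_weak _ _ (1 + 2).+1) => //; apply: wexec_branch => //=.
    by wstep; wstep.
  apply: wexec_weak; [apply: wexec_branch => //=; wstep; apply: wexec_fseq|].
      apply: wexec_combine; [done|reflexivity|reflexivity|reflexivity|reflexivity|lia].
    wsimpl; rewrite -/(le_word r c) le_wordE er (negbTE nsel) /=.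
    by apply: wexec_branch => //=; wstep; wstep.
  by [].
exists (add_word (v t) S), (add_word [:: true] C).
have lC : size (add_word [:: true] C) <= (maxn 1 (size C)).+1 := size_add_word _ _.
have lS := size_add_word (v t) S.
split.
- by rewrite val_add_word mul1n addnC.
- by rewrite val_add_word addnC.
- by lia.
move: sel lv lS; rewrite /selected; case ev: (v t) => [|x w] //= sel lv lS.
apply: wexec_weak; [apply: wexec_branch => //=; wstep; apply: wexec_fseq|].
    apply: wexec_combine; [done|reflexivity|reflexivity|reflexivity|reflexivity|lia].
  wsimpl; rewrite -/(le_word r c) le_wordE er sel /=.
  apply: wexec_branch => //=; wstep; apply: wexec_fseq.
    apply: wexec_combine; [done|reflexivity|reflexivity|reflexivity|reflexivity|].
    by rewrite /=; lia.
  wsimpl.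
  apply: wexec_combine; [done|reflexivity|reflexivity|reflexivity|reflexivity|].
  by rewrite /=; lia.
by [].
Qed.

(** Answers are pushed, hence pile up in the reverse order of [us]. The machine runs this on the
    reversed list of TAs, so the output ends up in the right order. *)
Lemma wexec_process_loop B N us S C s1 s2 s4 s5 s7 s8 s9 s10 s11 s12 s15 :
  (forall t, [/\ size (v t) <= N, size (d t) <= N & size (n t) <= N]) ->
  size c <= N -> 2 * N + size ts + maxn N (size S) + maxn 1 (size C) + 2 * size us + 6 <= B ->
  exists S' C', [/\ word_val S' = word_val S + sumn [seq selected t * word_val (v t) | t <- us],
    word_val C' = word_val C + count selected us,
    size S' <= maxn N (size S) + size us /\ size C' <= maxn 1 (size C) + size us &
    wexec B (while16 0 isSome process) (((12 * N + 40) * size ts + 31) * size us + 1)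
      [:: records us; s1; s2; records ts; c :: s4; s5; [::]; s7; S :: s8; C :: s9;
          s10; s11; s12; [::]; [::]; s15]
      [:: [::]; s1; s2; records ts; c :: s4; s5; [::]; s7; S' :: s8; C' :: s9;
          s10; s11; s12; [::]; [::]; rev [seq nseq (selected t) true | t <- us] ++ s15]].
Proof.
move=> lN lc; elim: us S C s15 => [|t us IH] S C s15 lB.
  exists S, C; split; rewrite ?addn0 //; first by lia.
  by apply: (@wexec_weak _ _ 1); [wstep|lia].
rewrite /= in lB.
have [|S1 [C1 [eS1 eC1 [lS1 lC1] H1]]] := @wexec_process B N t S C (records us) s1 s2 s4 s5
   s7 s8 s9 s10 s11 s12 s15 lN lc; first by lia.
have [|S2 [C2 [eS2 eC2 [lS2 lC2] H2]]] := IH S1 C1 (nseq (selected t) true :: s15).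
  by lia.
exists S2, C2; split.
- by rewrite eS2 eS1 /= -addnA.
- by rewrite eC2 eC1 /= -addnA.
- by rewrite /=; lia.
apply: (@wexec_weak _ _ (((12 * N + 40) * size ts + 30) +
  (((12 * N + 40) * size ts + 31) * size us + 1)).+1); last by rewrite /= mulnS; lia.
rewrite /= rev_cons cat_rcons.
exact: (@wexec_loop_step B 0 _ _ _ _ _ _ (v t) [:: d t, n t & records us] _ _ H1 H2).
Qed.

End Records.

(* The input has [4 m + 5] words when there are [m] TAs, so reading it four words
   at a time after the first five tallies [m] without decoding its binary form. *)
Definition read_all : frag16 :=
  mov 0 1 ;; mov 0 1 ;; mov 0 1 ;; mov 0 1 ;; mov 0 1 ;;
  while16 0 isSome (mov 0 1 ;; mov 0 1 ;; mov 0 1 ;; mov 0 1 ;; push 15 2 None).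

Definition split_utils : frag16 := while16 2 isSome (mov 1 3 ;; discard 15 2).

Definition group : frag16 := while16 2 isSome (mov 2 6 ;; mov 1 6 ;; mov 1 6).

Definition duplicate : frag16 :=
  while16 6 isSome (dup 15 13 6 0 ;; dup 15 13 6 3 ;; discard 15 6).

(** After the reversal on tape 1 the threshold comes first, then the values of the TAs, the capacity
    and the grades. The values wait on tape 3 until the capacity is taken; the return to tape 2, by
    then emptied of the tally, puts them back in the order of the grades. *)
Definition parse : frag16 :=
  read_all ;; mov 1 5 ;; mov 1 5 ;; split_utils ;; mov 1 4 ;; mov_all 3 2 ;;
  group ;; duplicate.

(** The remaining separator is the word of 0, which is the whole encoding of a negative answer. *)
Definition refuse : frag16 :=
  while16 15 isSome (discard 15 15) ;; push 15 15 None.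

(** With threshold [nk / dk], total [S] and capacity [c], the average is tested as
    [nk * c <= S * dk]. A positive verdict is the word of 1 and becomes the leading 1 of the
    output. *)
Definition decide : frag16 :=
  dup 15 13 4 10 ;; le_frag 10 9 ;;
  branch16 9 (fun o => if is_bit o then
    mov 5 10 ;; mov 4 11 ;; mul_frag ;; mov 8 10 ;; mov 5 11 ;; mul_frag ;;
    mov 12 10 ;; le_frag 12 10 ;;
    branch16 10 (fun o => if is_bit o then mov 10 15 else refuse)
  else refuse).

Definition solver : frag16 :=
  parse ;; push 15 8 None ;; push 15 9 None ;; while16 0 isSome process ;; decide.

(** * Parsing and final decision *)

Section Solver.
Variable B : nat.

Lemma wexec_read_loop m ws s1 s2 s3 s4 s5 s6 s7 s8 s9 s10 s11 s12 s15 :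
  size ws = 4 * m ->
  wexec B (while16 0 isSome (mov 0 1 ;; mov 0 1 ;; mov 0 1 ;; mov 0 1 ;; push 15 2 None))
    (10 * m + 1)
    [:: ws; s1; s2; s3; s4; s5; s6; s7; s8; s9; s10; s11; s12; [::]; [::]; s15]
    [:: [::]; rev ws ++ s1; nseq m [::] ++ s2; s3; s4; s5; s6; s7; s8; s9; s10; s11; s12;
        [::]; [::]; s15].
Proof.
elim: m ws s1 s2 => [|m IH] ws s1 s2 sz.
  by case: ws sz => // _; wstep.
case: ws sz => [|w1 [|w2 [|w3 [|w4 ws]]]]; rewrite ?mulnS //= => sz.
apply: (@wexec_weak _ _ ((2 + (2 + (2 + (2 + 1)))) + (10 * m + 1)).+1); last by lia.
apply: (@wexec_loop_step B 0 _ _ _ _ _ _ w1 [:: w2, w3, w4 & ws]) => //.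
  by do 5![wstep].
have -> : [:: [::] & nseq m [::] ++ s2] = nseq m [::] ++ [:: [::] & s2] :> seq (seq bool).
  by elim: (m) => //= k ->.
rewrite !rev_cons !cat_rcons; apply: IH; lia.
Qed.

Lemma wexec_split_utils vs s0 s1 s3 s4 s5 s6 s7 s8 s9 s10 s11 s12 s15 :
  wexec B split_utils (4 * size vs + 1)
    [:: s0; vs ++ s1; nseq (size vs) [::]; s3; s4; s5; s6; s7; s8; s9; s10; s11; s12;
        [::]; [::]; s15]
    [:: s0; s1; [::]; rev vs ++ s3; s4; s5; s6; s7; s8; s9; s10; s11; s12;
        [::]; [::]; s15].
Proof.
elim: vs s3 => [|w vs IH] s3; first by wstep.
apply: (@wexec_weak _ _ ((2 + 1) + (4 * size vs + 1)).+1); last by rewrite /=; lia.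
apply: (@wexec_loop_step B 2 _ _ _ _ _ _ [::] (nseq (size vs) [::])) => //.
  by do 2![wstep].
rewrite rev_cons cat_rcons; exact: IH.
Qed.

Lemma wexec_duplicate s s0 s1 s2 s3 s4 s5 s7 s8 s9 s10 s11 s12 s15 :
  wexec B duplicate (4 * size s + 1)
    [:: s0; s1; s2; s3; s4; s5; s; s7; s8; s9; s10; s11; s12; [::]; [::]; s15]
    [:: rev s ++ s0; s1; s2; rev s ++ s3; s4; s5; [::]; s7; s8; s9; s10; s11; s12;
        [::]; [::]; s15].
Proof.
elim: s s0 s3 => [|w s IH] s0 s3; first by wstep.
apply: (@wexec_weak _ _ ((1 + (1 + 1)) + (4 * size s + 1)).+1); last by rewrite /=; lia.
apply: (@wexec_loop_step B 6 _ _ _ _ _ _ w s) => //.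
  by do 3![wstep].
rewrite rev_cons !cat_rcons; exact: IH.
Qed.

Section Records.
Variables (T : Type) (v d n : T -> seq bool).

Lemma wexec_group ts s0 s1 s3 s4 s5 s6 s7 s8 s9 s10 s11 s12 s15 :
  wexec B group (7 * size ts + 1)
    [:: s0; flatten [seq [:: d t; n t] | t <- ts] ++ s1; map v ts; s3; s4; s5; s6; s7; s8;
        s9; s10; s11; s12; [::]; [::]; s15]
    [:: s0; s1; [::]; s3; s4; s5; rev (records v d n ts) ++ s6; s7; s8; s9; s10; s11; s12;
        [::]; [::]; s15].
Proof.
elim: ts s6 => [|t ts IH] s6; first by wstep.
apply: (@wexec_weak _ _ ((2 + (2 + 2)) + (7 * size ts + 1)).+1); last by rewrite /=; lia.
apply: (@wexec_loop_step B 2 _ _ _ _ _ _ (v t) (map v ts)) => //.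
  by do 3![wstep].
rewrite /records /= !rev_cons !cat_rcons; exact: IH.
Qed.

(** Layout of an encoded one-course instance: the two counts, the utilities [us] of the TAs, the
    grades, the capacity, the values of the TAs to the course, the threshold. *)
Definition input_words (w0 w1 : seq bool) us ts c nk dk : seq (seq bool) :=
  [:: w0; w1] ++ us ++ flatten [seq [:: n t; d t] | t <- ts] ++ [:: c] ++ map v ts ++
  [:: nk; dk].

Lemma wexec_parse w0 w1 us ts c nk dk : size us = size ts ->
  exists r, wexec B parse (50 * size ts + 50)
    [:: input_words w0 w1 us ts c nk dk; [::]; [::]; [::]; [::]; [::]; [::]; [::];
        [::]; [::]; [::]; [::]; [::]; [::]; [::]; [::]]
    [:: records v d n (rev ts); r; [::]; records v d n (rev ts); [:: c]; [:: nk; dk];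
        [::]; [::]; [::]; [::]; [::]; [::]; [::]; [::]; [::]; [::]].
Proof.
move=> sz; exists (rev us ++ [:: w1; w0]).
set ws := input_words _ _ _ _ _ _ _.
have ssz : size ws = 4 * size ts + 5.
  rewrite /ws /input_words !size_cat size_map /= sz.
  suff -> : size (flatten [seq [:: n t; d t] | t <- ts]) = 2 * size ts by lia.
  by elim: (ts) => //= t ts' ->; rewrite mulnS.
(* Reversal puts each denominator before its numerator, which is where the field order of [records]
   comes from. *)
have erev : rev ws = [:: dk, nk & map v (rev ts) ++
    c :: (flatten [seq [:: d t; n t] | t <- rev ts] ++ rev us ++ [:: w1; w0])].
  rewrite /ws /input_words !rev_cat /= -!catA /= -map_rev; congr [:: _, _ & _ ++ (_ :: _ ++ _)].
  elim: (ts) => //= t ts' IH; rewrite !rev_cons -!cats1 map_cat flatten_cat -IH -!catA //.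
case: ws ssz erev => [|a1 [|a2 [|a3 [|a4 [|a5 ws]]]]]; rewrite ?addnS //= => [[]] ssz erev.
apply: wexec_weak.
  rewrite /parse; apply: wexec_fseq.
    rewrite /read_all; do 5![wstep].
    by apply: (@wexec_read_loop (size ts)); rewrite ssz addn0.
  wsimpl.
  have -> : rev ws ++ [:: a5; a4; a3; a2; a1] = rev [:: a1, a2, a3, a4, a5 & ws].
    by rewrite !rev_cons -!cats1 -!catA.
  rewrite erev cats0; do 2![wstep].
  apply: wexec_fseq.
    have -> : size ts = size (map v (rev ts)) by rewrite size_map size_rev.
    exact: wexec_split_utils.
  wsimpl; wstep.
  apply: wexec_fseq.
    by apply: wexec_mov_all; reflexivity.
  wsimpl; rewrite !cats0 revK.
  apply: wexec_fseq; first exact: wexec_group.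
  wsimpl; have := @wexec_duplicate (rev (records v d n (rev ts)) ++ [::])
    [::] (rev us ++ [:: w1; w0]) [::] [::] [:: c] [:: nk; dk] [::] [::] [::] [::]
    [::] [::] [::].
  by rewrite !cats0 revK; apply.
rewrite /= !(size_map, size_rev, size_cat, size_records) /=; lia.
Qed.

End Records.

Lemma wexec_refuse s0 s1 s2 s3 s4 s5 s6 s7 s8 s9 s10 s11 s12 s15 :
  wexec B refuse (2 * size s15 + 2)
    [:: s0; s1; s2; s3; s4; s5; s6; s7; s8; s9; s10; s11; s12; [::]; [::]; s15]
    [:: s0; s1; s2; s3; s4; s5; s6; s7; s8; s9; s10; s11; s12; [::]; [::]; [:: [::]]].
Proof.
apply: (@wexec_weak _ _ ((2 * size s15 + 1) + 1)); last by lia.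
apply: (@wexec_fseq _ _ _ _ _ _ [:: s0; s1; s2; s3; s4; s5; s6; s7; s8; s9; s10; s11; s12;
  [::]; [::]; [::]]); last by wstep.
elim: s15 => [|w s IH]; first by wstep.
apply: (@wexec_weak _ _ (1 + (2 * size s + 1)).+1); last by rewrite /=; lia.
by apply: wexec_loop_step IH => //; wstep.
Qed.

Lemma wexec_decide N c nk dk S C s0 s1 s2 s3 s6 s7 out :
  size c <= N -> size nk <= N -> size dk <= N -> size S + size C + 2 * N + 5 <= B ->
  exists2 W, nth [::] W 15 =
      if (word_val c <= word_val C) && (word_val nk * word_val c <= word_val S * word_val dk)
      then [:: true] :: out else [:: [::]] &
    wexec B decide (6 * (N + size S) + 2 * size out + 60)
    [:: s0; s1; s2; s3; [:: c]; [:: nk; dk]; s6; s7; [:: S]; [:: C]; [::]; [::];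
        [::]; [::]; [::]; out] W.
Proof.
move=> lc lnk ldk lB.
suff [W eW H] : exists2 W, nth [::] W 15 =
      if (word_val c <= word_val C) && (word_val nk * word_val c <= word_val S * word_val dk)
      then [:: true] :: out else [:: [::]] &
    wexec B (branch16 9 (fun o => if is_bit o then
        mov 5 10 ;; mov 4 11 ;; mul_frag ;; mov 8 10 ;; mov 5 11 ;; mul_frag ;;
        mov 12 10 ;; le_frag 12 10 ;;
        branch16 10 (fun o => if is_bit o then mov 10 15 else refuse)
      else refuse)) (6 * (N + size S) + 2 * size out + 50)
    [:: s0; s1; s2; s3; [:: c]; [:: nk; dk]; s6; s7; [:: S]; [:: le_word c C]; [::]; [::];
        [::]; [::]; [::]; out] W.
  exists W => //; apply: wexec_weak.
    rewrite /decide; wstep; apply: wexec_fseq.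
      apply: wexec_combine; [done|reflexivity|reflexivity|reflexivity|reflexivity|lia].
    wsimpl; exact: H.
  by lia.
rewrite le_wordE; case: (_ <= _) => /=; last first.
  eexists; last first.
    apply: wexec_weak; first by apply: wexec_branch => //=; exact: wexec_refuse.
    by lia.
  by [].
have [|z1 [e1 l1 H1]] := @wexec_mul B nk c s0 s1 s2 s3 [::] [:: dk] s6 s7 [:: S] [:: [:: true]]
  [::] [::] [::] out _; first by lia.
have [|z2 [e2 l2 H2]] := @wexec_mul B S dk s0 s1 s2 s3 [::] [::] s6 s7 [::] [:: [:: true]]
  [::] [::] [:: z1] out _; first by lia.
rewrite -e1 -e2.
suff [W eW H] : exists2 W, nth [::] W 15 =
      if word_val z1 <= word_val z2 then [:: true] :: out else [:: [::]] &
    wexec B (branch16 10 (fun o => if is_bit o then mov 10 15 else refuse))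
      (2 * size out + 10)
    [:: s0; s1; s2; s3; [::]; [::]; s6; s7; [::]; [:: [:: true]]; [:: le_word z1 z2]; [::];
        [::]; [::]; [::]; out] W.
  exists W => //; apply: wexec_weak; [apply: wexec_branch => //=|].
    do 2![wstep]; apply: wexec_fseq H1 _; do 2![wstep]; apply: wexec_fseq H2 _; wstep.
    apply: wexec_fseq.
      apply: wexec_combine; [done|reflexivity|reflexivity|reflexivity|reflexivity|lia].
    wsimpl; exact: H.
  by lia.
rewrite le_wordE; case: (_ <= _) => /=.
  eexists; last first.
    apply: wexec_weak; first by apply: wexec_branch => //=; wstep.
    by lia.
  by [].
eexists; last first.
  apply: wexec_weak; first by apply: wexec_branch => //=; exact: wexec_refuse.
  by lia.
by [].
Qed.

End Solver.

(** * Correctness and running time of the whole machine *)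

Section Main.
Variables (T : Type) (v d n : T -> seq bool).

Definition answer_words (ts : seq T) (c nk dk : seq bool) : seq (seq bool) :=
  let sel := selected v d n ts c in
  if (word_val c <= count sel ts) &&
     (word_val nk * word_val c <=
        sumn [seq sel t * word_val (v t) | t <- ts] * word_val dk)
  then [:: true] :: [seq nseq (sel t) true | t <- ts] else [:: [::]].

Lemma selected_rev ts c : selected v d n (rev ts) c =1 selected v d n ts c.
Proof. by move=> t; rewrite /selected count_rev. Qed.

(** [N] bounds both the word lengths and the number of TAs. There is one comparison per ordered pair
    of TAs, each taking linearly many units, and a unit is linear in [N]: hence the fourth power. *)
Lemma solver_correct N w0 w1 us ts c nk dk : size us = size ts ->
  (forall t, [/\ size (v t) <= N, size (d t) <= N & size (n t) <= N]) ->
  (forall w, w \in input_words v d n w0 w1 us ts c nk dk -> size w <= N) ->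
  size ts <= N ->
  outputs_within (machine_of solver) (enc_words (input_words v d n w0 w1 us ts c nk dk))
    (200 * 440 * N.+1 ^ 4) (enc_words (answer_words ts c nk dk)).
Proof.
move=> sz lN lw lts.
have inW w : w \in [:: c; nk; dk] -> size w <= N.
  by move=> hw; apply: lw; rewrite /input_words !mem_cat; move: hw;
    rewrite !inE => /or3P[]->; rewrite ?orbT.
have [lc lnk ldk] : [/\ size c <= N, size nk <= N & size dk <= N].
  by split; apply: inW; rewrite !inE eqxx ?orbT.
(* The processing loop makes the largest demand on [B], at most [6 * N + 7]; the rest is slack. *)
pose B := 8 * N + 10.
have [r Hparse] := @wexec_parse B T v d n w0 w1 us ts c nk dk sz.
have lr : size (rev ts) = size ts by rewrite size_rev.
have [|S [C [eS eC [lS lC] Hloop]]] := @wexec_process_loop T v d n (rev ts) c B N (rev ts)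
  [::] [::] r [::] [::] [:: nk; dk] [::] [::] [::] [::] [::] [::] [::] lN lc.
  by rewrite lr /B /=; lia.
have [|W eW Hdec] := @wexec_decide B N c nk dk S C [::] r [::] (records v d n (rev ts))
  [::] [::] (rev [seq nseq (selected v d n (rev ts) c t) true | t <- rev ts]) lc lnk ldk.
  by rewrite /= in lS lC; rewrite /B; lia.
have H : wexec B solver (200 * N.+1 ^ 3)
    [:: input_words v d n w0 w1 us ts c nk dk; [::]; [::]; [::]; [::]; [::]; [::]; [::];
        [::]; [::]; [::]; [::]; [::]; [::]; [::]; [::]] W.
  apply: wexec_weak.
    rewrite /solver; apply: wexec_fseq Hparse _; do 2![wstep].
    rewrite cats0 in Hloop.
    apply: wexec_fseq Hloop _; exact: Hdec.
  rewrite /= in lS lC; rewrite !(size_rev, size_map).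
  rewrite size_rev in lS lC.
  have : ((12 * N + 40) * size ts + 31) * size ts <= ((12 * N + 40) * N + 31) * N.
    by rewrite leq_mul // leq_add2r leq_mul2l lts orbT.
  have : ((12 * N + 40) * N + 31) * N + 100 * N + 120 <= 200 * N.+1 ^ 3.
    by rewrite !expnS expn0; nia.
  by move: lS lC lts; rewrite /=; lia.
have [|He _] := H.
  case=> [|k] w; first by move=> /lw; rewrite /B; lia.
  by move: k; do 15![case=> //]; move=> k; rewrite [nth _ _ _]nth_nil.
have -> : answer_words ts c nk dk = nth [::] W 15.
  rewrite eW /answer_words eC eS /= !add0n count_rev !map_rev sumn_rev revK.
  rewrite (eq_count (selected_rev ts c)).
  rewrite (eq_map (fun t => congr1 (fun b : bool => b * word_val (v t)) (selected_rev ts c t))).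
  by rewrite (eq_map (fun t => congr1 (fun b : bool => nseq b true) (selected_rev ts c t))).
apply: exec_outputs (exec_weak He _) => //.
  by case=> //; do 16?[case=> //].
(* With this [B] a unit is [320 * N + 440] steps, at most [440 * N.+1]. *)
have -> : 200 * 440 * N.+1 ^ 4 = 200 * N.+1 ^ 3 * (440 * N.+1).
  by rewrite [RHS]mulnACA -expnSr.
by rewrite leq_mul2l /cost_unit /B; apply/orP; right; lia.
Qed.

End Main.

Import Order.TTheory GRing.Theory Num.Theory.

(** * MEFE matchings with one course *)

Lemma word_val_bits k : word_val (bits k) = k.
Proof.
rewrite /bits -[RHS]bin_of_natK; case: bin_of_nat => //=.
by elim=> //= p ->; rewrite NatTrec.doubleE //.
Qed.

Lemma nilp_bits k : nilp (bits k) = (k == 0).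
Proof.
apply/idP/eqP=> [/nilP e|->//]; by rewrite -(word_val_bits k) e.
Qed.

Lemma enc_natsE s : enc_nats s = enc_words (map bits s).
Proof. by rewrite /enc_nats /enc_words -map_comp. Qed.

Lemma size_enc_words s : size (enc_words s) = sumn [seq (size w).+1 | w <- s].
Proof.
elim: s => //= w s IH.
by rewrite enc_words_cons size_cat size_map /= IH addnS addSn.
Qed.

Lemma size_enc_words_ge s : size s <= size (enc_words s).
Proof. rewrite size_enc_words; elim: s => //= w s; lia. Qed.

Lemma size_word_le s w : w \in s -> size w <= size (enc_words s).
Proof.
rewrite size_enc_words; elim: s => //= u s IH; rewrite inE => /predU1P[->|/IH]; lia.
Qed.

Local Open Scope ring_scope.

Lemma rat_absz (x : rat) : 0 <= x -> x = (`|numq x|%N)%:R / (`|denq x|%N)%:R.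
Proof.
move=> x0; rewrite -{1}(divq_num_den x).
by rewrite !natr_absz ger0_norm ?numq_ge0 // ger0_norm ?denq_ge0.
Qed.

Lemma le_rat_absz (x y : rat) : 0 <= x -> 0 <= y ->
  (x <= y) = (`|denq x| * `|numq y| >= `|numq x| * `|denq y|)%N.
Proof.
move=> x0 y0; have dpos z : 0 < (`|denq z|%N)%:R :> rat.
  by rewrite ltr0n absz_gt0 denq_neq0.
rewrite {1}(rat_absz x0) {1}(rat_absz y0) ler_pdivrMr // mulrAC ler_pdivlMr //.
by rewrite -!natrM ler_nat [X in (_ <= X)%N]mulnC.
Qed.

(** * The only candidate for the assigned set *)

Section Merit.
Variables (T : finType) (g : T -> rat) (u : T -> nat) (c : nat).

(** The inequality is weak: a TA of positive value counts itself, and ties count on both sides. *)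
Definition outranks (t t' : T) : bool := (0 < u t')%N && (g t <= g t').

Definition admitted : {set T} := [set t | (0 < u t)%N && (#|outranks t| <= c)%N].

Lemma in_admitted t : (t \in admitted) = (0 < u t)%N && (#|outranks t| <= c)%N.
Proof. by rewrite inE. Qed.

Lemma card_admitted_le : (#|admitted| <= c)%N.
Proof.
have [->|[t0 t0A]] := set_0Vmem admitted; first by rewrite cards0.
case: (arg_minP g t0A) => t tA' tmin; have tA : t \in admitted := tA'.
have : (#|outranks t| <= c)%N by move: (tA); rewrite in_admitted => /andP[].
apply: leq_trans; apply: subset_leq_card; apply/subsetP=> t' t'A.
by rewrite unfold_in /outranks tmin // andbT; move: t'A; rewrite in_admitted => /andP[].
Qed.

Lemma admitted_upward t t' : t \in admitted -> (0 < u t')%N -> g t <= g t' -> t' \in admitted.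
Proof.
rewrite !in_admitted => /andP[_ le] -> /= gt; apply: leq_trans le.
apply: subset_leq_card; apply/subsetP=> s; rewrite !unfold_in /outranks.
by case/andP=> -> /(le_trans gt).
Qed.

(** For a member of [S], everyone counted lies in [S], so the count is at most [c]. For an outsider
    of positive value, every member of [S] is counted, since otherwise closure would bring the
    outsider in; counting the outsider too exceeds [c]. *)
Lemma eq_admitted (S : {set T}) : #|S| = c -> (forall t, t \in S -> (0 < u t)%N) ->
  (forall t t', t \in S -> (0 < u t')%N -> g t <= g t' -> t' \in S) -> S = admitted.
Proof.
move=> cS posS upS; apply/setP=> t; rewrite in_admitted; apply/idP/andP=> [tS|[ut le]].
  split; first exact: posS.
  rewrite -cS; apply: subset_leq_card; apply/subsetP=> t'.
  by rewrite unfold_in => /andP[]; apply: upS.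
apply: contraLR le => tS; rewrite -ltnNge -cS; apply: proper_card.
apply/properP; split; last by exists t; rewrite // unfold_in /outranks ut lexx.
apply/subsetP=> t' t'S; rewrite unfold_in /outranks posS //=.
case: (lerP (g t) (g t')) => // /ltW gt; by rewrite (upS t' t) in tS.
Qed.

End Merit.

(** * One-course matchings and their encoding *)

Section OneCourse.
Variable I : instance.
Hypothesis one : courses I = 1%N.

Let x0 : 'I_(courses I) := cast_ord (esym one) ord0.

Lemma course_unique (x : 'I_(courses I)) : x = x0.
Proof.
apply: val_inj; have := leq_trans (ltn_ord x) (eq_leq one).
by rewrite /= ltnS leqn0 => /eqP.
Qed.

(** The value to the course is positive exactly when the TA's own utility is, and it is also what
    the average sums; one number per TA serves both purposes. *)
Let util t : nat := course_util x0 t.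
Let chosen : {set 'I_(tas I)} := admitted (fun t => grade t x0) util (capacity x0).

Lemma util_gt0 t : (0 < util t)%N = (ta_util t x0 != 0%N).
Proof.
case: eqP => [/course_util0|/course_util_gt0]; rewrite /util; last by move->.
by move->.
Qed.

Definition chosen_matching : matching I :=
  [ffun t => if t \in chosen then Some x0 else None].

Lemma assigned_chosen : assigned chosen_matching x0 = chosen.
Proof. by apply/setP=> t; rewrite inE ffunE; case: ifP; rewrite ?eqxx. Qed.

(** Upward closure is envy-freeness: an unassigned TA has utility 0, so if it values the course and
    its grade is at least that of an assigned TA, it envies that TA. *)
Lemma MEFE_assigned (mu : matching I) : MEFE mu -> assigned mu x0 = chosen.
Proof.
move=> [[cap pos] _ nenvy]; apply: eq_admitted => [|t|t t'].
- exact: cap.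
- by rewrite inE util_gt0 => /eqP/pos/eqP.
rewrite !inE util_gt0 => /eqP mt ut gt; apply/negPn/negP=> nt'.
apply: nenvy; exists t', t; split; first by move=> e; rewrite e mt eqxx in nt'.
exists x0; split=> //.
case mt' : (mu t') nt' => [x|] /=; last by rewrite lt0n.
by rewrite (course_unique x) eqxx.
Qed.

(** An inequality suffices for the capacity, as [card_admitted_le] gives the other one. *)
Definition admissible : Prop :=
  (capacity x0 <= #|chosen|)%N /\
  threshold I <= (capacity x0)%:R^-1 * \sum_(t in chosen) (util t)%:R.

Lemma MEFE_chosen : admissible -> MEFE chosen_matching.
Proof.
move=> [capl sat]; split; [split|..].
- move=> x; rewrite (course_unique x) assigned_chosen; apply/eqP.
  by rewrite eqn_leq capl card_admitted_le.
- move=> t x; rewrite (course_unique x) ffunE; case: ifP => // tc _.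
  by apply/eqP; rewrite -util_gt0; move: tc; rewrite in_admitted => /andP[].
- by move=> x; rewrite (course_unique x) /avg_util assigned_chosen.
move=> [t [t' [ntt' [x [et' gt]]]]]; rewrite (course_unique x) in et' gt *.
move: et'; rewrite !ffunE; case: ifP => // t'c _.
case: ifP => [_|/negP tc /=]; first by rewrite ltnn.
rewrite lt0n -util_gt0 => ut; apply: tc.
exact: (@admitted_upward _ (fun t => grade t x0) util _ t' t).
Qed.

Lemma MEFE_admissible (mu : matching I) : MEFE mu -> admissible.
Proof.
move=> H; have e := MEFE_assigned H; case: H => [[cap _] sat _]; split.
  by rewrite -e cap.
by have := sat x0; rewrite /avg_util e.
Qed.

Let bits_util t := bits (util t).
Let bits_num t := bits `|numq (grade t x0)|.
Let bits_den t := bits `|denq (grade t x0)|.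
Let tas_enum := enum 'I_(tas I).
Let words_in := input_words bits_util bits_den bits_num (bits (courses I)) (bits (tas I))
  [seq bits (ta_util t x0) | t <- tas_enum] tas_enum (bits (capacity x0))
  (bits `|numq (threshold I)|) (bits `|denq (threshold I)|).
Let words_out := answer_words bits_util bits_den bits_num tas_enum (bits (capacity x0))
  (bits `|numq (threshold I)|) (bits `|denq (threshold I)|).

Lemma enum_courses : enum 'I_(courses I) = [:: x0].
Proof.
have := size_enum_ord (courses I); rewrite [in RHS]one.
by case: (enum _) => [|x [|]] //= _; rewrite (course_unique x).
Qed.

Lemma enc_instanceE : enc_instance I = enc_words words_in.
Proof.
rewrite /enc_instance enum_courses enc_natsE; congr enc_words.
have allpairs1 (S : Type) (f : 'I_(tas I) -> 'I_(courses I) -> S) ts :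
    [seq f t x | t <- ts, x <- [:: x0]] = [seq f t x0 | t <- ts].
  by elim: ts => //= t ts ->.
rewrite !allpairs1 /words_in /input_words /= cats0 !map_cat /= -!map_comp.
do 2!congr (_ :: _); congr (_ ++ (_ ++ _)).
  by rewrite map_flatten -map_comp.
by rewrite map_cat -map_comp.
Qed.

Lemma beats_outranks t t' :
  beats bits_util bits_den bits_num t t' = outranks (fun t => grade t x0) util t t'.
Proof.
rewrite /beats /outranks nilp_bits lt0n; congr (_ && _).
rewrite le_rat_absz ?grade_ge0 // /bits_den /bits_num !word_val_bits.
by rewrite mulnC [X in (_ <= X)%N]mulnC.
Qed.

Lemma count_enum (P : pred 'I_(tas I)) : count P tas_enum = #|P|.
Proof. by rewrite cardE -size_filter /tas_enum enumT /enum_mem. Qed.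

Lemma selected_chosen t :
  selected bits_util bits_den bits_num tas_enum (bits (capacity x0)) t = (t \in chosen).
Proof.
rewrite /selected /chosen in_admitted nilp_bits lt0n word_val_bits.
by rewrite (eq_count (beats_outranks t)) count_enum.
Qed.

Definition admissibleb : bool :=
  (capacity x0 <= #|chosen|)%N &&
  (`|numq (threshold I)| * capacity x0 <=
     (\sum_(t in chosen) util t) * `|denq (threshold I)|)%N.

Lemma admissibleP : reflect admissible admissibleb.
Proof.
have dpos : 0 < (`|denq (threshold I)|%N)%:R :> rat.
  by rewrite ltr0n absz_gt0 denq_neq0.
have cpos : 0 < (capacity x0)%:R :> rat by rewrite ltr0n capacity_gt0.
have -> : admissibleb = (capacity x0 <= #|chosen|)%N &&
    (threshold I <= (capacity x0)%:R^-1 * \sum_(t in chosen) (util t)%:R).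
  rewrite /admissibleb; congr (_ && _).
  rewrite {3}(rat_absz (threshold_ge0 I)) ler_pdivrMr // -mulrA ler_pdivlMl //.
  by rewrite -natr_sum -!natrM ler_nat mulnC.
exact: andP.
Qed.

Lemma words_outE : words_out =
  if admissibleb then [:: true] :: [seq nseq (t \in chosen) true | t <- tas_enum]
  else [:: [::]].
Proof.
rewrite /words_out /answer_words !word_val_bits (eq_count selected_chosen) count_enum.
rewrite (eq_map (fun t => congr1 (fun b : bool => nseq b true) (selected_chosen t))).
rewrite sumnE big_map /tas_enum big_enum /=.
congr (if _ && (_ <= _ * _)%N then _ else _).
rewrite [RHS]big_mkcond; apply: eq_bigr => t _.
by rewrite selected_chosen word_val_bits; case: ifP; rewrite ?mul1n.
Qed.

Lemma solver_solves : exists2 ans : option (matching I), correct_answer ans &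
  outputs_within (machine_of solver) (enc_instance I)
    (200 * 440 * (size (enc_instance I)).+1 ^ 4) (enc_answer ans).
Proof.
exists (if admissibleb then Some chosen_matching else None).
  case: admissibleP => [/MEFE_chosen//|nadm [mu /MEFE_admissible]]; exact: nadm.
have -> : enc_answer (if admissibleb then Some chosen_matching else None) =
    enc_words words_out.
  rewrite words_outE /enc_answer enc_natsE; congr enc_words.
  case: admissibleb => //=; congr cons; rewrite -map_comp; apply: eq_map => t /=.
  (* The course has index 0, so an assigned TA is encoded by 1, whose word is the single digit
     [true]. *)
  rewrite ffunE; case: ifP => //= _; rewrite one //.
rewrite enc_instanceE; set N := size _.
have inN w : w \in words_in -> (size w <= N)%N by apply: size_word_le.
apply: solver_correct => //; first by rewrite size_map.
- move=> t; have tin : t \in tas_enum by rewrite mem_enum.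
  split; apply: inN; rewrite /words_in /input_words !mem_cat ?map_f ?orbT //.
  + by rewrite (_ : _ \in flatten _) ?orbT //; apply/flatten_mapP; exists t;
      rewrite // !inE eqxx orbT.
  + by rewrite (_ : _ \in flatten _) ?orbT //; apply/flatten_mapP; exists t; rewrite // !inE eqxx.
(* Every word, even that of 0, contributes its separator, so the number of TAs is at most the input
   length. *)
apply: leq_trans (size_enc_words_ge _).
by rewrite /words_in /input_words size_cat size_cat size_map addnCA leq_addr.
Qed.

End OneCourse.

Lemma horner_time (a k : nat) : (a%:P * ('X + 1) ^+ 4).[k] = (a * k.+1 ^ 4)%N.
Proof. by rewrite !expnS expn0 muln1 !mulnA !hornerE -(addn1 k). Qed.

Theorem corollary2 :
  MEFE_matching_polytime_on (fun I : instance => courses I = 1%N).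
Proof.
exists (machine_of solver), ((200 * 440)%N%:P * ('X + 1) ^+ 4) => I one.
have [ans ok out] := solver_solves one; exists ans => //.
by rewrite horner_time.
Qed.
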